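(* Let $s$ be a positive integer, and let $X$ denote the size of a partition chosen uniformly at random from the set of $(s,s+1)$-core partitions. Then the ninth moment of $X$ about its mean is $$\mathbf{E}\big[(X-\mathbf{E}[X])^9\big]=\frac{1}{182467650613248000}\, s^2(s-1)(s-2)(2s+1)(s+1)^2\,P(s),$$ where $$\begin{aligned}P(s)={}&28092743584s^{20}-284614603048s^{19}+908242721124s^{18}-87722680542s^{17}-4040707469643s^{16}\\&+1347179583168s^{15}+11350317109273s^{14}+4824122583716s^{13}-15816684214230s^{12}\\&-31535118689736s^{11}-29475404073738s^{10}+2671156715274s^9+63014451511513s^8\\&+79700408583680s^7+45859575725901s^6-377516262865248s^5+6309067352294376s^4\\&+10737857697068736s^3-38301852570773760s^2-26103018295756800s+48704747653094400.\end{aligned}$$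
   Context: A partition is a non-increasing finite sequence of positive integers $\lambda=(\lambda_1,\dots,\lambda_k)$, $k\ge 0$ (the empty partition is allowed); its size is $\lambda_1+\dots+\lambda_k$. Its Ferrers diagram consists of the cells $(i,j)$ with $1\le i\le k$, $1\le j\le\lambda_i$. The hook length of cell $(i,j)$ is $\lambda_i-j+\lambda'_j-i+1$, where $\lambda'$ is the conjugate partition ($\lambda'_j$ = number of $i$ with $\lambda_i\ge j$). A partition is an $s$-core if no cell has hook length equal to $s$, and an $(s,t)$-core partition if it is simultaneously an $s$-core and a $t$-core. The set of $(s,s+1)$-core partitions is finite, and it is given the uniform probability distribution. *)

(* Defs.v *)
From HB Require Import structures.
From mathcomp Require Import all_boot all_order all_algebra finmap.
From mathcomp Require Import boolp classical_sets functions cardinality fsbigop.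
From mathcomp Require Import zify.

Set Implicit Arguments.
Unset Strict Implicit.
Unset Printing Implicit Defensive.

Import GRing.Theory Num.Theory.

Local Open Scope classical_set_scope.
Local Open Scope nat_scope.

Definition is_partition (l : seq nat) : bool := sorted geq l && all (leq 1) l.

(* Rows and columns are numbered from 1: [part l i] is lambda_i. *)
Definition part (l : seq nat) (i : nat) : nat := nth 0 l i.-1.

Definition conj_part (l : seq nat) (j : nat) : nat := count (leq j) l.

Definition is_cell (l : seq nat) (i j : nat) : bool :=
  (1 <= i <= size l) && (1 <= j <= part l i).

(* On a cell, j <= lambda_i and i <= lambda'_j, so neither subtraction is
   truncated. *)
Definition hook_length (l : seq nat) (i j : nat) : nat :=
  (part l i - j) + (conj_part l j - i) + 1.

Definition is_core (s : nat) (l : seq nat) : Prop :=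
  forall i j : nat, is_cell l i j -> hook_length l i j <> s.

Definition simultaneous_cores (s t : nat) : set (seq nat) :=
  [set l | [/\ is_partition l, is_core s l & is_core t l]].

(* Expectation of f under the uniform distribution on A; meaningful when A is
   finite and nonempty. *)
Definition uniform_expectation (T : choiceType) (A : set T) (f : T -> rat) : rat :=
  ((\sum_(x \in A) f x) / (#|` fset_set A|)%:R)%R.

Definition partition_size (l : seq nat) : rat := ((sumn l)%:R)%R.

(* The rest of the file shows that [simultaneous_cores s s.+1] is finite and
   nonempty, so that [uniform_expectation] applies to it. The argument uses the
   first-column hook lengths h_i: the set of those of an s-core is closed under
   subtraction of s. *)

Definition first_col_hook (l : seq nat) (k : nat) : nat :=
  nth 0 l k + (size l - k.+1).

Lemma partition_nth_le l a b :
  is_partition l -> a <= b -> nth 0 l b <= nth 0 l a.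
Proof.
move=> /andP[sl _] ab; case: (ltnP b (size l)) => bl; last by rewrite (nth_default _ bl).
by apply: (sorted_leq_nth (leT := geq)) => //; rewrite ?inE //;
  [move=> x y z /= yx zy; apply: leq_trans zy yx | apply: leqnn | lia].
Qed.

Lemma partition_nth_gt0 l a : is_partition l -> a < size l -> 0 < nth 0 l a.
Proof. by move=> /andP[_ /all_nthP al] /al; apply. Qed.

Lemma conj_partE l j c : c <= size l ->
  (forall k, k < c -> j <= nth 0 l k) ->
  (forall k, c <= k -> k < size l -> nth 0 l k < j) ->
  conj_part l j = c.
Proof.
move=> cl H1 H2; rewrite /conj_part -[in LHS](cat_take_drop c l) count_cat.
have -> : count (leq j) (take c l) = c.
  rewrite -[RHS](size_takel cl); apply/eqP; rewrite -all_count.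
  apply/(all_nthP 0) => k; rewrite size_takel // => kc.
  by rewrite nth_take //; apply: H1.
have -> : count (leq j) (drop c l) = 0; last by rewrite addn0.
apply/eqP; rewrite -leqn0 leqNgt -has_count; apply/negP => /(has_nthP 0) [k].
rewrite size_drop nth_drop => kl; rewrite leqNgt H2 //; lia.
Qed.

Lemma core_hook_sub s l a : is_partition l -> is_core s l ->
  a < size l -> s <= first_col_hook l a ->
  exists2 b, b < size l & first_col_hook l b = first_col_hook l a - s.
Proof.
move=> pl cl al sa; set m := first_col_hook l a - s.
case: (pselect (exists2 b, b < size l & first_col_hook l b = m)) => // nex.
case: (posnP s) => [s0|s_gt0]; first by exists a => //; rewrite /m s0 subn0.
have nm b : b < size l -> first_col_hook l b <> m by move=> bl e; apply: nex; exists b.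
pose P k := first_col_hook l k <= m.
pose c := find P (iota 0 (size l)).
have cn : c <= size l by rewrite -[X in _ <= X](size_iota 0) find_size.
have Hlt k : k < c -> m < first_col_hook l k.
  move=> kc; have /= := before_find 0 kc; rewrite nth_iota ?add0n; last by lia.
  by move/negbT; rewrite /P -ltnNge.
have Hge k : c <= k -> k < size l -> first_col_hook l k < m.
  move=> ck kl.
  have hP : has P (iota 0 (size l)) by rewrite has_find size_iota -/c; lia.
  have := nth_find 0 hP; rewrite -/c nth_iota ?add0n; last by lia.
  rewrite /P /first_col_hook => Pc; have lkc := partition_nth_le pl ck.
  have := nm k kl; rewrite /first_col_hook; lia.
have ac : a < c by case: (ltnP a c) => // ca; have := Hge a ca al; rewrite /m; lia.
pose j := m + c + 1 - size l.
have jn : size l < m + c + 1.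
  case: (ltnP c (size l)) => cl'; last by lia.
  by have := Hge c (leqnn _) cl'; have := partition_nth_gt0 pl cl'; rewrite /first_col_hook; lia.
have cj k : k < c -> j <= nth 0 l k.
  move=> kc; have := Hlt c.-1 ltac:(lia); have := partition_nth_le (a:=k) (b:=c.-1) pl ltac:(lia).
  rewrite /first_col_hook /j; lia.
have jc : conj_part l j = c.
  apply: conj_partE => // k ck kl; have := Hge k ck kl.
  have := Hge c (leqnn _) ltac:(lia); have := partition_nth_le pl ck.
  rewrite /first_col_hook /j; lia.
case: (cl a.+1 j).
  by rewrite /is_cell /part /= al cj //= andbT /j; lia.
have := cj a ac.
by move: jn sa; rewrite /hook_length jc /part /= /j /m /first_col_hook; lia.
Qed.

Lemma core_first_col_hook_lt s l a : 0 < s -> is_partition l ->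
  is_core s l -> is_core s.+1 l -> a < size l -> first_col_hook l a < s * s.
Proof.
move=> s0 pl cs ct al; rewrite ltnNge; apply/negP => big.
have pos b : b < size l -> 0 < first_col_hook l b.
  by move=> bl; have := partition_nth_gt0 pl bl; rewrite /first_col_hook; lia.
have step u : forall k b, is_core u l -> b < size l -> k * u <= first_col_hook l b ->
    exists2 b', b' < size l & first_col_hook l b' = first_col_hook l b - k * u.
  elim=> [|k IH] b cu bl kb; first by exists b => //; rewrite mul0n subn0.
  have [|b1 b1l e1] := IH b cu bl; first by lia.
  have [|b2 b2l e2] := core_hook_sub pl cu b1l; first by lia.
  by exists b2 => //; rewrite e2 e1; lia.
set h := first_col_hook l a in big *.
have hE := divn_eq h s; have rs := ltn_pmod h s0.
have qs : s <= h %/ s by rewrite leq_divRL.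
have hE2 : h = (h %/ s - h %% s) * s + (h %% s) * s.+1.
  have rq : h %% s * s <= h %/ s * s by rewrite leq_mul2r; lia.
  by rewrite mulnBl mulnS; lia.
have [|b bl e] := step s (h %/ s - h %% s) a cs al; first by rewrite -/h; lia.
have [|b' b'l e'] := step s.+1 (h %% s) b ct bl; first by rewrite e -/h; lia.
by have := pos b' b'l; rewrite e' e -/h; lia.
Qed.

Lemma finite_simultaneous_cores s : 0 < s ->
  finite_set (simultaneous_cores s s.+1).
Proof.
move=> s0; pose N := s * s.
have fT : finite_set (range (fun t : N.-bseq 'I_N.+1 => map val (bseqval t))).
  by apply: finite_image; apply: finite_finset.
apply: sub_finite_set fT => l /= [pl cs ct].
have hb k : k < size l -> nth 0 l k + (size l - k.+1) < N.
  by move=> kl; apply: (core_first_col_hook_lt s0 pl cs ct kl).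
have sl : size l <= N by case: (posnP (size l)) => [->|/hb]; lia.
have sl' : size (map (@inord N) l) <= N by rewrite size_map.
exists (Bseq sl') => //=; rewrite -map_comp -[RHS]map_id.
apply/eq_in_map => x /(nthP 0) [k kl <-] /=; rewrite inordK //.
by have := hb k kl; lia.
Qed.

Lemma nil_simultaneous_cores s t : simultaneous_cores s t [::].
Proof. by split=> // i j; rewrite /is_cell /=; lia. Qed.

(* Main.v *)
(* A subset of the integers closed under subtraction of a and b is the trace of
   a closed lattice walk with a steps +b and b steps -a, read up to rotation;
   for b = a + 1 the rotations that are nonnegative at all times represent the
   (a, a+1)-cores, by the cycle lemma.  The size of the core is, up to a
   constant, the variance of the a starting points of the +b steps.  As this is
   invariant under rotation, cores may be replaced by all walks.

   Let M(a, b) be the r-th central moment of the size for all walks with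
   parameters a and b.  For fixed a it is a polynomial in b of degree at most
   2r, and Ehrhart-type reciprocity gives M(a, -a-b) = M(a, b).  Telescoping
   sums of squares and cubes show that the variance may as well be computed from
   the -a steps, hence M(a, b) = M(b, a).  A polynomial with these symmetries is
   determined by its values at 0 <= a, b <= r: for r = 1 this gives the mean, for
   r = 9 a finite computation. *)
From Stdlib Require Import ZArith.
Require Import Defs.
From HB Require Import structures.
From mathcomp Require Import all_boot all_order all_algebra finmap.
From mathcomp Require Import boolp classical_sets functions cardinality fsbigop.
From mathcomp Require Import zify ring ssrZ.
Import GRing.Theory Num.Theory.
Local Open Scope ring_scope.

Set Implicit Arguments.
Unset Strict Implicit.
Unset Printing Implicit Defensive.

(** * Words and rotations *)

(** Polynomiality in [b] for fixed [a] needs every [b], coprime to [a] or not; closed walks exist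
    for all pairs, and [b = a + 1] enters only with the cycle lemma. The first letter is fixed to be
    [true] because reciprocity for sums over [x] weakly decreasing counts bounded by [y] sends [y]
    to [- x.+1 - y]: with [x = a - 1] free counts this is [- a - b]. The substitution negates every
    position, and the variance is even in the positions, so odd [r] obey the same law as even [r]. A
    sum over [words x y] of an expression of degree [2 r] has degree at most [2 r + x] in [y] and
    vanishes at [-1, ..., -x], as ['C(x + y, x)] does; hence the degree [2 r] of the mean. No
    quotient is formed: the candidate is subtracted from each summand and the resulting sum is shown
    to be zero. For [b = a + 1], dividing the position of a [true] step by [a] gives as quotient the
    level of the walk with steps +1 and -1, so the cycle lemma for unit steps suffices. *)

Fixpoint words (a b : nat) : seq (seq bool) :=
  match a with
  | 0 => [:: nseq b false]
  | a'.+1 => (fix wb (b : nat) := match b with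
      | 0 => [:: nseq a'.+1 true]
      | b'.+1 => [seq true :: w | w <- words a' b'.+1] ++
                 [seq false :: w | w <- wb b']
      end) b
  end.

Lemma wordsSS a b : words a.+1 b.+1 =
  [seq true :: w | w <- words a b.+1] ++ [seq false :: w | w <- words a.+1 b].
Proof. by []. Qed.

Lemma wordsS0 a : words a.+1 0 = [seq true :: w | w <- words a 0].
Proof. by case: a. Qed.

Lemma mem_words a b w :
  (w \in words a b) = (count id w == a) && (count negb w == b).
Proof.
elim: w a b => [|x w IHw] a b.
  case: a => [|a]; first by rewrite mem_seq1; case: b.
  elim: b => [|b IHb]; first by rewrite mem_seq1.
  by rewrite wordsSS mem_cat; apply/norP; split; apply/mapP => -[].
have tE z (t : seq (seq bool)) y :
    (z :: w \in [seq y :: v | v <- t]) = (z == y) && (w \in t).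
  case: eqP => [->|ne] /=; first by rewrite mem_map // => u v [].
  by apply/mapP => -[v _ [e]]; case: ne.
case: a => [|a].
  rewrite mem_seq1; case: b => [|b]; first by case: x; rewrite /= ?andbF.
  rewrite -[nseq _ _]/(false :: nseq b false) eqseq_cons.
  have := IHw 0 b; rewrite mem_seq1 => ->.
  by case: x => //=; rewrite !add0n add1n eqSS.
case: b => [|b].
  rewrite wordsS0 tE IHw; case: x => //=; rewrite ?add1n ?add0n ?eqSS //.
  by rewrite andbF.
by rewrite wordsSS mem_cat !tE !IHw; case: x; rewrite /= ?add1n ?add0n ?eqSS ?orbF.
Qed.

Lemma uniq_words a b : uniq (words a b).
Proof.
elim: a b => [|a IHa] b //; elim: b => [|b IHb] //.
rewrite wordsSS cat_uniq !map_inj_uniq ?IHa ?IHb //=; try by move=> u v [].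
rewrite andbT; apply/hasPn => w /mapP [v _ ->]; by apply/mapP => -[].
Qed.

Lemma size_words a b : size (words a b) = 'C(a + b, a).
Proof.
elim: a b => [|a IHa] b; first by rewrite add0n bin0.
elim: b => [|b IHb]; first by rewrite addn0 binn.
by rewrite wordsSS size_cat !size_map IHa IHb [RHS]binS [RHS]addnC addSnnS.
Qed.

Lemma words_size a b w : w \in words a b -> size w = (a + b)%N.
Proof.
by rewrite mem_words => /andP[/eqP <- /eqP <-]; rewrite -(count_predC id).
Qed.

Lemma perm_words_rot k a b : perm_eq [seq rot k w | w <- words a b] (words a b).
Proof.
apply: uniq_perm; rewrite ?map_inj_uniq ?uniq_words //; try exact: rot_inj.
move=> w; apply/mapP/idP => [[v hv ->]|hw].
  by move: hv; rewrite !mem_words !(permP (permEl (perm_rot _ _))).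
exists (rotr k w); last by rewrite rotrK.
by move: hw; rewrite !mem_words !(permP (permEl (perm_rotr _ _))).
Qed.

Lemma perm_words_negb a b : perm_eq [seq map negb w | w <- words a b] (words b a).
Proof.
have negbK' : cancel (map negb) (map negb) by apply: mapK negbK.
have cE w : (count id (map negb w) = count negb w) *
            (count negb (map negb w) = count id w).
  by rewrite !count_map; split; apply: eq_count => x //=; rewrite negbK.
apply: uniq_perm; rewrite ?map_inj_uniq ?uniq_words //; try exact: can_inj negbK'.
move=> w; apply/mapP/idP => [[v hv ->]|hw].
  by move: hv; rewrite !mem_words !cE andbC.
by exists (map negb w); rewrite ?negbK' // mem_words !cE andbC -mem_words.
Qed.

(** Double counting of the pairs of a word and a rotation index, each [rot k] being a permutation of
    [words a b]. It serves twice: for the rotations that start with [true], and for those singled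
    out by the cycle lemma. *)
Lemma rot_double_count (R : nzRingType) a b (F : seq bool -> R) (P : pred (seq bool)) :
  (forall k w, w \in words a b -> F (rot k w) = F w) ->
  \sum_(w <- words a b) F w *+ (\sum_(k < a + b) P (rot k w)) =
  (\sum_(w <- words a b | P w) F w) *+ (a + b).
Proof.
move=> FR; transitivity (\sum_(k < a + b) \sum_(w <- words a b | P w) F w); last first.
  by rewrite sumr_const card_ord.
rewrite (eq_bigr (fun w => \sum_(k < a + b) F w *+ P (rot k w))); last first.
  by move=> w _; rewrite sumrMnr.
rewrite exchange_big /=; apply: eq_bigr => k _.
rewrite -[RHS](perm_big _ (perm_words_rot k a b)) big_map /= [RHS]big_mkcond /=.
rewrite big_seq [RHS]big_seq; apply: eq_bigr => w hw; rewrite FR //.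
by case: (P _).
Qed.

(* A word stands for the walk with steps [+ b] (for [true]) and [- a] (for
   [false]) that ends at 0; [height a b w] is the position from which the rest
   [w] of the word is read. *)
Definition height (a b : rat) (w : seq bool) : rat :=
  a * (count negb w)%:R - b * (count id w)%:R.

Fixpoint step_sum (a b : rat) (x : bool) (g : rat -> rat) (w : seq bool) : rat :=
  if w is y :: w' then
    (if y == x then g (height a b w) else 0) + step_sum a b x g w'
  else 0.

(** Half the variance of the starting points; the subtracted constant is half the variance of
    [0, ..., a - 1], the starting points that belong to the empty core. *)
Definition core_size (a b : rat) (w : seq bool) : rat :=
  (a * step_sum a b true (fun p => p ^+ 2) w
     - step_sum a b true id w ^+ 2) / (2 * a ^+ 2) - (a ^+ 2 - 1) / 24.

Definition mean_size (a b : rat) : rat := (a - 1) * (b - 1) * (a + b + 1) / 24.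

Definition centered_size (a b : rat) (w : seq bool) : rat :=
  core_size a b w - mean_size a b.

Lemma height_cons a b x w :
  height a b (x :: w) = height a b w + (if x then - b else a).
Proof. by rewrite /height /= !natrD; case: x; rewrite /=; ring. Qed.

Lemma height_rcons a b x w :
  height a b (rcons w x) = height a b w + (if x then - b else a).
Proof.
by rewrite -cats1 /height !count_cat /= !natrD; case: x; rewrite /=; ring.
Qed.

Lemma height_words (a b : nat) w : w \in words a b -> height a%:R b%:R w = 0.
Proof.
by rewrite mem_words => /andP[/eqP ca /eqP cb]; rewrite /height ca cb mulrC subrr.
Qed.

Lemma eq_step_sum a b x g g' w : g =1 g' -> step_sum a b x g w = step_sum a b x g' w.
Proof. by move=> e; elim: w => //= y w ->; rewrite e. Qed.

Lemma step_sum_sqr a b x (d : rat) w :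
  step_sum a b x (fun p => (p + d) ^+ 2) w =
  step_sum a b x (fun p => p ^+ 2) w + 2 * d * step_sum a b x id w
    + d ^+ 2 * (count (pred1 x) w)%:R.
Proof.
elim: w => [|y w IH] /=; first by ring.
by rewrite IH natrD; case: eqP => _ /=; ring.
Qed.

Lemma step_sum_shift a b x (d : rat) w :
  step_sum a b x (fun p => p + d) w =
  step_sum a b x id w + d * (count (pred1 x) w)%:R.
Proof.
elim: w => [|y w IH] /=; first by ring.
by rewrite IH natrD; case: eqP => _ /=; ring.
Qed.

Lemma count_pred1_true w : count (pred1 true) w = count id w.
Proof. by apply: eq_count => -[]. Qed.

Lemma step_sum_rcons a b x g y w :
  step_sum a b x g (rcons w y) =
  step_sum a b x (fun p => g (p + (if y then - b else a))) w
  + (if y == x then g (if y then - b else a) else 0).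
Proof.
elim: w => [|z w IH]; first by rewrite /= height_cons /height /= !mulr0 subr0 !add0r ?addr0.
rewrite rcons_cons /= IH -rcons_cons height_rcons !addrA.
by [].
Qed.

Lemma step_sum_rot1 a b x g y w : height a b (y :: w) = 0 ->
  step_sum a b x g (rcons w y) =
  step_sum a b x (fun p => g (p + (if y then - b else a))) (y :: w).
Proof.
by move=> h; rewrite step_sum_rcons /= h add0r addrC.
Qed.

(** Moving the first letter to the end translates all positions by minus its step, since the walk is
    closed; a variance does not see translations. *)
Lemma core_size_rot1 (a b : nat) w : (0 < a)%N -> w \in words a b ->
  core_size a%:R b%:R (rot 1 w) = core_size a%:R b%:R w.
Proof.
case: w => [|y w] a0 hw; first by [].
have h := height_words hw.
rewrite rot1_cons /core_size !step_sum_rot1 //.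
move: hw; rewrite mem_words => /andP[/eqP ca _].
rewrite step_sum_sqr step_sum_shift count_pred1_true ca.
have a1 : (a%:R : rat) != 0 by rewrite pnatr_eq0 -lt0n.
congr (_ / _ - _); ring.
Qed.

Lemma core_size_rot (a b k : nat) w : (0 < a)%N -> w \in words a b ->
  core_size a%:R b%:R (rot k w) = core_size a%:R b%:R w.
Proof.
move=> a0; elim: k w => [|k IH] w hw; first by rewrite rot0.
have [lk|gk] := ltnP k (size w); last by rewrite rot_oversize // ltnW.
rewrite -add1n rotD ?add1n // core_size_rot1 ?IH //.
by rewrite mem_words !(permP (permEl (perm_rot _ _))) -mem_words.
Qed.

(* A closed walk has telescoping sums of squares and cubes; these express the
   spread over the starts of one letter by the spread over the other. *)
Lemma step_sum_telescope2 a b w :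
  2 * b * step_sum a b true id w + b ^+ 2 * (count id w)%:R
  - 2 * a * step_sum a b false id w + a ^+ 2 * (count negb w)%:R
  + height a b w ^+ 2 = 0.
Proof.
elim: w => [|y w IH]; first by rewrite /height /=; ring.
rewrite -[RHS]IH /= !natrD height_cons; case: y => /=; ring.
Qed.

Lemma step_sum_telescope3 a b w :
  3 * b * step_sum a b true (fun p => p ^+ 2) w
  + 3 * b ^+ 2 * step_sum a b true id w + b ^+ 3 * (count id w)%:R
  - 3 * a * step_sum a b false (fun p => p ^+ 2) w
  + 3 * a ^+ 2 * step_sum a b false id w - a ^+ 3 * (count negb w)%:R
  + height a b w ^+ 3 = 0.
Proof.
elim: w => [|y w IH]; first by rewrite /height /=; ring.
rewrite -[RHS]IH /= !natrD height_cons; case: y => /=; ring.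
Qed.

Lemma step_sum_negb a b x g w :
  step_sum b a x g (map negb w) = step_sum a b (~~ x) (fun p => g (- p)) w.
Proof.
elim: w => //= y w ->; rewrite -map_cons.
have -> : height b a (map negb (y :: w)) = - height a b (y :: w).
  rewrite /height !count_map.
  rewrite (@eq_count _ (preim negb negb) id); last by case.
  by rewrite (@eq_count _ (preim negb id) negb) // opprB.
by case: y; case: x.
Qed.

Lemma core_size_negb (a b : nat) w : (0 < a)%N -> (0 < b)%N -> w \in words a b ->
  core_size b%:R a%:R (map negb w) = core_size a%:R b%:R w.
Proof.
move=> a0 b0 hw; have h := height_words hw.
have a1 : (a%:R : rat) != 0 by rewrite pnatr_eq0 -lt0n.
have b1 : (b%:R : rat) != 0 by rewrite pnatr_eq0 -lt0n.
have := step_sum_telescope2 a%:R b%:R w; have := step_sum_telescope3 a%:R b%:R w.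
rewrite h; move: hw; rewrite mem_words => /andP[/eqP -> /eqP ->].
rewrite /core_size !step_sum_negb /=.
have -> : step_sum a%:R b%:R false (fun p => - p) w = - step_sum a%:R b%:R false id w.
  by elim: w {h} => [|y w IH] /=; rewrite ?oppr0 // IH; case: y => /=; ring.
rewrite (@eq_step_sum _ _ false (fun p => (- p) ^+ 2) (fun p => p ^+ 2)); last first.
  by move=> p; rewrite sqrrN.
move: (step_sum _ _ false id w) (step_sum _ _ true id w) => n1 e1.
move: (step_sum _ _ false _ w) (step_sum _ _ true _ w) => n2 e2.
move: (a%:R : rat) (b%:R : rat) a1 b1 => A B A1 B1 h3 h2.
(* The telescoped squares give the linear sum over the [false] steps, and then the telescoped cubes
   give their sum of squares. *)
have n1E : n1 = (2 * B * e1 + B ^+ 2 * A + A ^+ 2 * B) / (2 * A).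
  apply: (mulIf (x := 2 * A)); first by rewrite mulf_neq0.
  rewrite divfK ?mulf_neq0 //; apply/eqP; rewrite -subr_eq0 -oppr_eq0 -[X in _ == X]h2.
  by apply/eqP; ring.
have n2E : n2 = (3 * B * e2 + 3 * B ^+ 2 * e1 + B ^+ 3 * A + 3 * A ^+ 2 * n1
                 - A ^+ 3 * B) / (3 * A).
  apply: (mulIf (x := 3 * A)); first by rewrite mulf_neq0.
  rewrite divfK ?mulf_neq0 //; apply/eqP; rewrite -subr_eq0 -oppr_eq0 -[X in _ == X]h3.
  by apply/eqP; ring.
rewrite n2E n1E; field; by rewrite A1.
Qed.

Lemma mean_sizeC a b : mean_size a b = mean_size b a.
Proof. by rewrite /mean_size; ring. Qed.

(** * Moments over all walks, and over the walks starting with [true] *)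

Definition moment_sum (r a b : nat) : rat :=
  \sum_(w <- words a b) centered_size a%:R b%:R w ^+ r.

Lemma moment_sumC r a b : (0 < a)%N -> (0 < b)%N ->
  moment_sum r a b = moment_sum r b a.
Proof.
move=> a0 b0; rewrite /moment_sum -[RHS](perm_big _ (perm_words_negb a b)) big_map.
rewrite big_seq [RHS]big_seq; apply: eq_bigr => w hw.
by rewrite /centered_size core_size_negb // mean_sizeC.
Qed.

Lemma sum_words_head (R : nzRingType) a b (F : seq bool -> R) :
  \sum_(w <- words a.+1 b | head false w) F w = \sum_(w <- words a b) F (true :: w).
Proof.
case: b => [|b]; first by rewrite wordsS0 big_map.
by rewrite wordsSS big_cat !big_map /= [X in _ + X]big_pred0 // addr0.
Qed.

Lemma sum_rot_head w : (\sum_(k < size w) head false (rot k w) = count id w)%N.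
Proof.
transitivity (\sum_(k < size w) nth false w k)%N.
  apply: eq_bigr => k _; congr nat_of_bool.
  by rewrite -nth0 /rot nth_cat size_drop subn_gt0 ltn_ord nth_drop addn0.
rewrite -(big_mkord predT (fun k => nat_of_bool (nth false w k))).
by rewrite -(big_nth false predT nat_of_bool) -sum1_count [RHS]big_mkcond;
   apply: eq_bigr => -[].
Qed.

Lemma moment_sum_head r a b :
  moment_sum r a.+1 b *+ a.+1 =
  (\sum_(w <- words a b) centered_size a.+1%:R b%:R (true :: w) ^+ r) *+ (a.+1 + b).
Proof.
rewrite -(sum_words_head _ _ (fun w => centered_size a.+1%:R b%:R w ^+ r)).
rewrite -rot_double_count; last first.
  by move=> k w hw; rewrite /centered_size core_size_rot.
rewrite /moment_sum -sumrMnl big_seq [RHS]big_seq; apply: eq_bigr => w hw.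
congr (_ *+ _); rewrite -(words_size hw) sum_rot_head.
by move: hw; rewrite mem_words => /andP[/eqP ->].
Qed.

(** * Polynomiality and reciprocity *)

Lemma antidifference n (q : {poly rat}) : (size q <= n)%N ->
  exists g : {poly rat}, [/\ (size g <= n.+1)%N, g.[-1] = 0 &
                             forall y, g.[y] - g.[y - 1] = q.[y]].
Proof.
(* The products [(X + 1) ... (X + n)] satisfy [f k.+1 (y) - f k.+1 (y - 1) = (k + 1) f k (y)], and
   all but [f 0] vanish at -1. The value 0 at -1 is the empty sum: [g(y)] adds up
   [q(0), ..., q(y)]. *)
pose f n : {poly rat} := \prod_(i <- iota 0 n) ('X - (- (i.+1%:R))%:P).
have sf k : size (f k) = k.+1 by rewrite size_prod_XsubC size_iota.
have fS k y : (f k.+1).[y] = (f k).[y] * (y + k.+1%:R).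
  have -> : f k.+1 = f k * ('X - (- (k.+1%:R))%:P).
    by rewrite /f -[k.+1 in LHS]addn1 iotaD cats1 big_rcons /= mulrC.
  by rewrite hornerM hornerXsubC opprK.
have f_shift k y : (f k.+1).[y - 1] = y * (f k).[y].
  elim: k => [|k IH]; last by rewrite fS IH fS -[k.+2%:R]natr1; ring.
  by rewrite fS /f /= big_nil !hornerC; ring.
elim: n q => [|n IH] q sq.
  exists 0; move: sq; rewrite leqn0 size_poly_eq0 => /eqP ->.
  by split; rewrite ?size_poly0 ?horner0 // => y; rewrite !horner0 subr0.
have [|g [sg g1 gE]] := IH (q - q`_n *: f n).
  apply/leq_sizeP => j nj; rewrite coefB coefZ.
  have [->|ne] := eqVneq j n.
    have /monicP : f n \is monic by apply: monic_prod_XsubC.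
    by rewrite lead_coefE sf => ->; rewrite mulr1 subrr.
  have lj : (n < j)%N by rewrite ltn_neqAle eq_sym ne.
  rewrite (nth_default _ (leq_trans sq lj)) (@nth_default _ _ (f n) j) ?sf //.
  by rewrite mulr0 subr0.
exists (g + (q`_n / n.+1%:R) *: f n.+1).
have n1 : (n.+1%:R : rat) != 0 by rewrite pnatr_eq0.
split.
- rewrite (leq_trans (size_polyD _ _)) // geq_max (leq_trans sg) //=.
  by rewrite (leq_trans (size_scale_leq _ _)) // sf.
- by rewrite hornerD g1 hornerZ -[X in (f _).[X]]add0r f_shift mul0r mulr0 addr0.
- move=> y; rewrite !hornerD !hornerZ f_shift fS.
  have := gE y; rewrite hornerD hornerN hornerZ => e.
  have -> : q.[y] = (g.[y] - g.[y - 1]) + q`_n * (f n).[y] by rewrite e; ring.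
  by field; rewrite addrC natr1.
Qed.

(** On [words x y] these are the weakly decreasing sequences of length [x] in [[0, y]], that is, the
    lattice points of a dilated simplex, to which Ehrhart-type reciprocity applies. *)
Fixpoint north_counts (w : seq bool) : seq nat :=
  if w is x :: w' then
    if x then count negb w' :: north_counts w' else north_counts w'
  else [::].

(* The substitution that appears when a sum over [words x y] is continued to
   [- x.+1 - y]. *)
Fixpoint reflect_counts (r : seq nat) : seq rat :=
  if r is y :: r' then - (size r').+1%:R - y%:R :: reflect_counts r' else [::].

Fixpoint monomial (ks : seq nat) (r : seq rat) : rat :=
  if ks is k :: ks' then (if r is y :: r' then y ^+ k * monomial ks' r' else 1)
  else 1.

Lemma size_north_counts w : size (north_counts w) = count id w.
Proof. by elim: w => [|[] w IH] //=; rewrite IH. Qed.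

Lemma size_north_counts_words a b w : w \in words a b -> size (north_counts w) = a.
Proof. by rewrite size_north_counts mem_words => /andP[/eqP]. Qed.

Lemma size_reflect_counts r : size (reflect_counts r) = size r.
Proof. by elim: r => //= y r ->. Qed.

Lemma sum_north_counts0 x (G : seq nat -> rat) :
  \sum_(w <- words x.+1 0) G (north_counts w) =
  \sum_(w <- words x 0) G (0%N :: north_counts w).
Proof.
rewrite wordsS0 big_map /= big_seq [RHS]big_seq; apply: eq_bigr => w.
by rewrite mem_words => /andP[_ /eqP ->].
Qed.

Lemma sum_north_countsS x y (G : seq nat -> rat) :
  \sum_(w <- words x.+1 y.+1) G (north_counts w) =
  \sum_(w <- words x y.+1) G (y.+1 :: north_counts w)
  + \sum_(w <- words x.+1 y) G (north_counts w).
Proof.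
rewrite wordsSS big_cat !big_map /=; congr (_ + _).
rewrite big_seq [RHS]big_seq; apply: eq_bigr => w.
by rewrite mem_words => /andP[_ /eqP ->].
Qed.

(** Summing over the first count turns [Q] into the antidifference of [X^k Q]. Run backwards from
    -1, its recurrence meets the zeros of [Q] first, which makes it vanish down to [- x.+1]; beyond
    them it adds up the same kind of sum with reflected counts and the opposite sign. *)
Lemma monomial_sum_poly ks : exists Q : {poly rat},
  [/\ (size Q <= (sumn ks + size ks).+1)%N,
      forall y : nat, Q.[y%:R] =
        \sum_(w <- words (size ks) y) monomial ks [seq n%:R | n <- north_counts w],
      forall m : nat, (0 < m <= size ks)%N -> Q.[- m%:R] = 0 &
      forall y : nat, Q.[- (size ks).+1%:R - y%:R] = (-1) ^+ size ks *
        \sum_(w <- words (size ks) y) monomial ks (reflect_counts (north_counts w))].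
Proof.
elim: ks => [|k ks [Q [sQ Q1 Q0 Q2]]].
  exists 1; split; rewrite ?size_poly1 //.
  - by move=> y; rewrite big_seq1 hornerC; elim: y.
  - by case.
  - by move=> y; rewrite big_seq1 hornerC mul1r; elim: y.
set x := size ks in Q0 Q1 Q2 *.
have [|g [sg g1 gE]] := @antidifference (sumn ks + x + k).+1 ('X^k * Q).
  rewrite (leq_trans (size_polyMleq _ _)) // size_polyXn.
  by move: sQ; rewrite -/x; lia.
have gE' y : g.[y - 1] = g.[y] - y ^+ k * Q.[y].
  by rewrite -[y ^+ k]hornerXn -hornerM -gE; ring.
have g0 m : (0 < m <= x.+1)%N -> g.[- m%:R] = 0.
  elim: m => [//|m IH] /andP[_ mx]; have [->//|m0] := posnP m.
  rewrite -natr1 opprD gE' IH ?m0 ?(ltnW mx) // Q0 ?m0 //.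
  by rewrite mulr0 subr0.
exists g; split => //=.
- by apply: leq_trans sg _; rewrite addnS -addnA -addnA [(k + _)%N]addnC -addnA.
- elim=> [|y IH].
    rewrite (sum_north_counts0 _ (fun s => monomial (k :: ks) [seq n%:R | n <- s])) /=.
    rewrite -mulr_sumr -Q1; have := gE' 0; rewrite sub0r g1 => /eqP.
    by rewrite eq_sym subr_eq0 => /eqP.
  rewrite (sum_north_countsS _ _ (fun s => monomial (k :: ks) [seq n%:R | n <- s])) /=.
  rewrite -mulr_sumr -Q1 -IH; have := gE' y.+1%:R.
  by rewrite -[X in g.[X - 1]]natr1 addrK => ->; ring.
- have rE y : \sum_(w <- words x y) monomial (k :: ks)
        (reflect_counts (y :: north_counts w)) =
      (- x.+1%:R - y%:R) ^+ k *
      \sum_(w <- words x y) monomial ks (reflect_counts (north_counts w)).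
    rewrite mulr_sumr big_seq [RHS]big_seq; apply: eq_bigr => w hw /=.
    by rewrite (size_north_counts_words hw).
  elim=> [|y IH].
    rewrite (sum_north_counts0 _ (fun s => monomial (k :: ks) (reflect_counts s))).
    have Q20 := Q2 0%N; rewrite subr0 in Q20.
    rewrite rE !subr0 -[x.+2%:R]natr1 opprD gE' g0 ?leqnn // Q20 exprS; ring.
  rewrite (sum_north_countsS _ _ (fun s => monomial (k :: ks) (reflect_counts s))).
  rewrite rE mulrDr -IH.
  have -> : - x.+2%:R - y.+1%:R = (- x.+2%:R - y%:R) - 1 :> rat.
    by rewrite -[y.+1%:R]natr1; ring.
  (* One count fewer and a bound larger by one give the same argument, so the hypothesis on [Q]
     applies at [y.+1]. *)
  have e : - x.+2%:R - y%:R = - x.+1%:R - y.+1%:R :> rat.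
    by rewrite -[y.+1%:R]natr1 -[x.+2%:R]natr1; ring.
  by rewrite gE' {2 3}e Q2 exprS; ring.
Qed.

(* [F b r] is a polynomial of total degree at most [d] in [b] and the entries
   of [r], as far as lists [r] of size [x] are concerned; the entry
   [(c, m, ks)] stands for the term [c * b ^+ m * monomial ks r]. *)
Definition polyfun (x d : nat) (F : rat -> seq rat -> rat) : Prop :=
  exists2 L : seq (rat * nat * seq nat),
    all (fun t => (size t.2 == x) && (t.1.2 + sumn t.2 <= d)%N) L &
    forall b r, size r = x ->
      F b r = \sum_(t <- L) t.1.1 * b ^+ t.1.2 * monomial t.2 r.

Lemma polyfun_ext x d F G : (forall b r, size r = x -> F b r = G b r) ->
  polyfun x d F -> polyfun x d G.
Proof. by move=> e [L hL LE]; exists L => // b r sr; rewrite -e ?LE. Qed.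

Lemma monomial_nseq0 n r : monomial (nseq n 0) r = 1.
Proof. by elim: n r => [|n IH] [|y r] //=; rewrite IH expr0 mulr1. Qed.

Lemma polyfun_pow x d m (c : rat) : (m <= d)%N -> polyfun x d (fun b _ => c * b ^+ m).
Proof.
move=> md; exists [:: (c, m, nseq x 0)].
  by rewrite /= size_nseq eqxx sumn_nseq mul0n addn0 md.
by move=> b r _; rewrite big_seq1 monomial_nseq0 mulr1.
Qed.

Lemma polyfun_const x d (c : rat) : polyfun x d (fun _ _ => c).
Proof.
by apply: polyfun_ext (@polyfun_pow x d 0 c _) => // b r _; rewrite expr0 mulr1.
Qed.

Lemma polyfun_arg x d : (0 < d)%N -> polyfun x d (fun b _ => b).
Proof.
by move=> h; apply: polyfun_ext (@polyfun_pow x d 1 1 _) => // b r _; rewrite expr1 mul1r.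
Qed.

Lemma polyfun_head x : polyfun x.+1 1 (fun _ r => head 0 r).
Proof.
exists [:: (1, 0%N, 1%N :: nseq x 0)].
  by rewrite /= size_nseq eqxx sumn_nseq mul0n.
move=> b [|y r] // _.
by rewrite big_seq1 /= monomial_nseq0 !mul1r mulr1 expr1.
Qed.

Lemma polyfun_behead x d F : polyfun x d F -> polyfun x.+1 d (fun b r => F b (behead r)).
Proof.
case=> L hL LE; exists [seq (t.1, 0%N :: t.2) | t <- L].
  by rewrite all_map; apply: sub_all hL => t.
move=> b [|y r] // [sr]; rewrite /= LE // big_map; apply: eq_bigr => t _ /=.
by rewrite expr0 mul1r.
Qed.

Lemma polyfunD x d F G : polyfun x d F -> polyfun x d G ->
  polyfun x d (fun b r => F b r + G b r).
Proof.
move=> [L hL LE] [K hK KE]; exists (L ++ K); first by rewrite all_cat hL.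
by move=> b r sr; rewrite big_cat LE ?KE.
Qed.

Lemma monomialD k1 k2 r : size k1 = size r -> size k2 = size r ->
  monomial [seq p.1 + p.2 | p <- zip k1 k2]%N r = monomial k1 r * monomial k2 r.
Proof.
elim: r k1 k2 => [|y r IH] [|a k1] [|b k2] //=.
by move=> [s1] [s2]; rewrite IH // exprD; ring.
Qed.

Lemma polyfunM x d e F G : polyfun x d F -> polyfun x e G ->
  polyfun x (d + e) (fun b r => F b r * G b r).
Proof.
move=> [L hL LE] [K hK KE].
exists [seq (t.1.1 * u.1.1, (t.1.2 + u.1.2)%N,
             [seq p.1 + p.2 | p <- zip t.2 u.2]%N) | t <- L, u <- K].
  apply/allP => v /allpairsP[[t u] /= [tL uK ->]] /=.
  have /andP[/eqP st dt] := allP hL t tL; have /andP[/eqP su du] := allP hK u uK.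
  rewrite size_map size_zip st su minnn eqxx /=.
  have -> : sumn [seq p.1 + p.2 | p <- zip t.2 u.2]%N = (sumn t.2 + sumn u.2)%N.
    move: st su; elim: (x) t.2 u.2 => [|n IH] [|i k1] [|j k2] //= [s1] [s2].
    by rewrite IH //; lia.
  by rewrite addnACA leq_add.
move=> b r sr; rewrite LE // KE // big_allpairs_dep /= big_distrl /=.
rewrite big_seq [RHS]big_seq; apply: eq_bigr => t tL; rewrite big_distrr /=.
rewrite big_seq [RHS]big_seq; apply: eq_bigr => u uK.
have /andP[/eqP st _] := allP hL t tL; have /andP[/eqP su _] := allP hK u uK.
by rewrite monomialD ?st ?su ?sr // exprD; ring.
Qed.

Lemma polyfunX x d n F : polyfun x d F -> polyfun x (d * n) (fun b r => F b r ^+ n).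
Proof.
move=> hF; elim: n => [|n IH]; first exact: polyfun_ext (polyfun_const x _ 1).
rewrite mulnS; apply: polyfun_ext (polyfunM hF IH) => b r _.
by rewrite exprS.
Qed.

Lemma polyfun_sum_poly x d F : polyfun x d F -> exists Q : {poly rat},
  [/\ (size Q <= (d + x).+1)%N,
      forall y : nat, Q.[y%:R] =
        \sum_(w <- words x y) F y%:R [seq n%:R | n <- north_counts w],
      forall m : nat, (0 < m <= x)%N -> Q.[- m%:R] = 0 &
      forall y : nat, Q.[- x.+1%:R - y%:R] = (-1) ^+ x *
        \sum_(w <- words x y)
          F (- x.+1%:R - y%:R) (reflect_counts (north_counts w))].
Proof.
case=> L; elim: L F => [|[[c m] ks] L IH] F.
  move=> _ FE; exists 0; split; first by rewrite size_poly0.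
  - move=> y; rewrite horner0 big_seq big1 // => w hw.
    by rewrite FE ?big_nil // size_map (size_north_counts_words hw).
  - by move=> n _; rewrite horner0.
  - move=> y; rewrite horner0 big_seq big1 ?mulr0 // => w hw.
    by rewrite FE ?big_nil // size_reflect_counts (size_north_counts_words hw).
case/andP => /andP[/= /eqP sk dk] hL FE.
have [Q [sQ Q1 Q0 Q2]] := monomial_sum_poly ks.
have [|P [sP P1 P0 P2]] := IH (fun b r => \sum_(t <- L) t.1.1 * b ^+ t.1.2 * monomial t.2 r) hL.
  by [].
rewrite sk in sQ Q0 Q1 Q2; exists (c *: ('X^m * Q) + P); split.
- rewrite (leq_trans (size_polyD _ _)) // geq_max sP andbT.
  rewrite (leq_trans (size_scale_leq _ _)) // (leq_trans (size_polyMleq _ _)) //.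
  rewrite size_polyXn addSn /= (leq_trans (leq_add (leqnn m) sQ)) //.
  by rewrite addnS ltnS addnA leq_add2r.
- move=> y; rewrite hornerD hornerZ hornerM hornerXn Q1 P1 mulrA mulr_sumr -big_split.
  rewrite big_seq [RHS]big_seq; apply: eq_bigr => w hw.
  by rewrite FE ?big_cons // size_map (size_north_counts_words hw).
- by move=> n hn; rewrite hornerD hornerZ hornerM Q0 // P0 // !mulr0 addr0.
- move=> y; rewrite hornerD hornerZ hornerM hornerXn Q2 P2 !mulrA.
  rewrite [_ * (-1) ^+ x]mulrC -mulrA -mulrDr mulr_sumr -big_split.
  congr (_ * _); rewrite big_seq [RHS]big_seq; apply: eq_bigr => w hw.
  by rewrite FE ?big_cons // size_reflect_counts (size_north_counts_words hw).
Qed.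

(* The sum over words is a polynomial of degree at most [2 * r + x], and by
   reciprocity it vanishes at all integers from [- x.+1 - r] to [r]. *)
Lemma polyfun_sum_eq0 x r F : polyfun x (2 * r) F ->
  (forall (y : nat) w, w \in words x y ->
     F (- x.+1%:R - y%:R) (reflect_counts (north_counts w)) =
     F y%:R [seq n%:R | n <- north_counts w]) ->
  (forall y, (y <= r)%N ->
     \sum_(w <- words x y) F y%:R [seq n%:R | n <- north_counts w] = 0) ->
  forall y, \sum_(w <- words x y) F y%:R [seq n%:R | n <- north_counts w] = 0.
Proof.
move=> /polyfun_sum_poly [Q [sQ Q1 Q0 Q2]] hF hr y; rewrite -Q1.
suff -> : Q = 0 by rewrite horner0.
pose rs : seq rat := [seq i%:R - (r + x).+1%:R | i <- iota 0 (2 * r + x).+2].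
apply/eqP; apply: contraTT sQ => Qn0; rewrite -ltnNge.
have <- : size rs = (2 * r + x).+2 by rewrite size_map size_iota.
apply: ltnW; apply: max_poly_roots => //; last first.
  rewrite map_inj_uniq ?iota_uniq // => i j /addIr /eqP.
  by rewrite eqr_nat => /eqP.
apply/allP => z /mapP[i]; rewrite mem_iota => /andP[_ hi] ->; apply/rootP.
have [h1|h1] := leqP (r + x).+1 i.
  by rewrite -natrB // Q1 hr //; lia.
have [h2|h2] := leqP r.+1 i.
  have -> : i%:R - (r + x).+1%:R = - ((r + x).+1 - i)%:R :> rat.
    by rewrite natrB ?opprB // ltnW.
  by apply: Q0; lia.
have -> : i%:R - (r + x).+1%:R = - x.+1%:R - (r - i)%:R :> rat.
  rewrite natrB // -[(r + x).+1%:R]natr1 -[x.+1%:R]natr1 natrD; ring.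
rewrite Q2 big_seq (eq_bigr (fun w => F (r - i)%:R [seq n%:R | n <- north_counts w])).
  by rewrite -big_seq hr ?mulr0 // leq_subr.
by move=> w hw; rewrite hF.
Qed.

(** * The size as a quadratic polynomial in the counts *)

Fixpoint count_sum (a b : rat) (g : rat -> rat) (r : seq rat) : rat :=
  if r is y :: r' then g (a * y - b * (size r').+1%:R) + count_sum a b g r' else 0.

Lemma step_sum_north_counts a b g w :
  step_sum a b true g w = count_sum a b g [seq n%:R | n <- north_counts w].
Proof.
elim: w => [|x w IH] //=; case: x => //=; rewrite IH ?add0r //; congr (g _ + _).
by rewrite size_map size_north_counts /height /= add0n add1n.
Qed.

(** With [k] counts left, [a (- k - y) + (a + b) k = - (a y - b k)]: reflection negates each
    position. *)
Lemma count_sum_reflect a b g r :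
  count_sum a (- a - b) g (reflect_counts r) =
  count_sum a b (fun p => g (- p)) [seq n%:R | n <- r].
Proof.
elim: r => //= y r ->; congr (g _ + _); rewrite size_reflect_counts size_map.
ring.
Qed.

Lemma polyfun_step x (a : rat) :
  polyfun x.+1 1 (fun b r => a * head 0 r - b * (size (behead r)).+1%:R).
Proof.
apply: (@polyfun_ext _ _ (fun b r => a * head 0 r + b * - x.+1%:R)).
  by move=> b [|y r] //= [->]; rewrite mulrN.
apply: polyfunD.
  exact: (@polyfunM _ 0 1 (fun _ _ => a) _ (polyfun_const _ _ _) (polyfun_head _)).
exact: (@polyfunM _ 1 0 (fun b _ => b) _ (polyfun_arg _ _) (polyfun_const _ _ _)).
Qed.

Lemma polyfun_count_sum x (a : rat) k :
  polyfun x k (fun b r => count_sum a b (fun p => p ^+ k) r).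
Proof.
elim: x => [|x IH].
  by apply: polyfun_ext (polyfun_const _ _ 0) => b [].
apply: (@polyfun_ext _ _ (fun b r => (a * head 0 r - b * (size (behead r)).+1%:R) ^+ k
   + count_sum a b (fun p => p ^+ k) (behead r))); first by move=> b [].
apply: polyfunD; last exact: (polyfun_behead IH).
by have := polyfunX k (polyfun_step x a); rewrite mul1n.
Qed.

(** The leading step starts at 0 and adds nothing to either sum, so only the [x] later starting
    points remain. *)
Lemma centered_size_true x (b : nat) w : w \in words x b ->
  centered_size x.+1%:R b%:R (true :: w) =
  (x.+1%:R * count_sum x.+1%:R b%:R (fun p => p ^+ 2) [seq n%:R | n <- north_counts w]
   - count_sum x.+1%:R b%:R (fun p => p ^+ 1) [seq n%:R | n <- north_counts w] ^+ 2)
   / (2 * x.+1%:R ^+ 2) - (x.+1%:R ^+ 2 - 1) / 24 - mean_size x.+1%:R b%:R.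
Proof.
move=> hw; have hw' : true :: w \in words x.+1 b by move: hw; rewrite !mem_words.
rewrite /centered_size /core_size /= height_words // !step_sum_north_counts.
by rewrite !expr0n /= !add0r.
Qed.

(* [c] is the candidate for the [r]-th moment of [a = x.+1], as a polynomial in
   [b]. *)
Lemma moment_determined r x (c : {poly rat}) :
  (size c <= (2 * r).+1)%N ->
  (forall y : nat, c.[- x.+1%:R - y%:R] = c.[y%:R]) ->
  (forall y, (y <= r)%N ->
     \sum_(w <- words x y) (centered_size x.+1%:R y%:R (true :: w) ^+ r - c.[y%:R]) = 0) ->
  forall y, \sum_(w <- words x y)
     (centered_size x.+1%:R y%:R (true :: w) ^+ r - c.[y%:R]) = 0.
Proof.
move=> sc c_sym hr.
pose Y b s := (x.+1%:R * count_sum x.+1%:R b (fun p => p ^+ 2) s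
   - count_sum x.+1%:R b (fun p => p ^+ 1) s ^+ 2)
   / (2 * x.+1%:R ^+ 2) - (x.+1%:R ^+ 2 - 1) / 24 - mean_size x.+1%:R b.
have FE y : \sum_(w <- words x y) (centered_size x.+1%:R y%:R (true :: w) ^+ r - c.[y%:R])
    = \sum_(w <- words x y) (Y y%:R [seq n%:R | n <- north_counts w] ^+ r - c.[y%:R]).
  rewrite big_seq [RHS]big_seq; apply: eq_bigr => w hw.
  by rewrite centered_size_true.
move=> y; rewrite FE; apply: (@polyfun_sum_eq0 x r (fun b s => Y b s ^+ r - c.[b])).
- apply: polyfunD.
    (* In [b] and the counts jointly, the variance and [mean_size] both have degree two, so the
       [r]-th power has degree [2 * r]. *)
    apply: polyfunX; apply: (@polyfun_ext _ _ (fun b s =>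
       x.+1%:R / (2 * x.+1%:R ^+ 2) * count_sum x.+1%:R b (fun p => p ^+ 2) s
       + (- (2 * x.+1%:R ^+ 2)^-1) * count_sum x.+1%:R b (fun p => p ^+ 1) s ^+ 2
       + (- ((x.+1%:R ^+ 2 - 1) / 24) +
       (- (x%:R / 24)) * ((b + (-1)) * (b + x.+2%:R))))).
      by move=> b s _; rewrite /Y /mean_size -[x.+2%:R]natr1 -[x.+1%:R]natr1; field;
        rewrite natr1 pnatr_eq0.
    apply: polyfunD; first apply: polyfunD.
    + exact: (@polyfunM _ 0 2 (fun _ _ => _) _ (polyfun_const _ _ _) (polyfun_count_sum _ _ _)).
    + apply: (@polyfunM _ 0 2 (fun _ _ => _) _ (polyfun_const _ _ _)).
      exact: (@polyfunX _ 1 2 _ (polyfun_count_sum _ _ _)).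
    + apply: polyfunD; first exact: polyfun_const.
      apply: (@polyfunM _ 0 2 (fun _ _ => _) _ (polyfun_const _ _ _)).
      apply: (@polyfunM _ 1 1); apply: polyfunD; 
        by [apply: polyfun_arg | apply: polyfun_const].
  apply: (@polyfun_ext _ _ (fun b _ => \sum_(i < (2 * r).+1) (- c`_i) * b ^+ i)).
    move=> b s _; rewrite (horner_coef_wide _ sc) -sumrN.
    by apply: eq_bigr => i _; rewrite mulNr.
  suff hn n : (n <= (2 * r).+1)%N ->
      polyfun x (2 * r) (fun b _ => \sum_(i < n) (- c`_i) * b ^+ i) by exact: hn.
  elim: n => [|n IH] hn.
    by apply: polyfun_ext (polyfun_const _ _ 0) => b s _; rewrite big_ord0.
  apply: (@polyfun_ext _ _ (fun b s => \sum_(i < n) (- c`_i) * b ^+ i + (- c`_n) * b ^+ n)).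
    by move=> b s _; rewrite big_ord_recr.
  by apply: polyfunD; [exact: IH (ltnW hn) | exact: polyfun_pow].
(* Negated positions keep the sum of squares and change the sign of the linear sum, which enters
   squared; [mean_size] is itself invariant under [b -> - a - b]. *)
- move=> n w hw; rewrite c_sym /Y !count_sum_reflect.
  congr (_ ^+ _ - _).
  have s1 s : count_sum x.+1%:R n%:R (fun p => (- p) ^+ 1) s =
     - count_sum x.+1%:R n%:R (fun p => p ^+ 1) s.
    by elim: s => [|z s IH] /=; rewrite ?oppr0 // IH !expr1; ring.
  have s2 s : count_sum x.+1%:R n%:R (fun p => (- p) ^+ 2) s =
     count_sum x.+1%:R n%:R (fun p => p ^+ 2) s.
    by elim: s => [|z s IH] //=; rewrite IH sqrrN.
  rewrite s1 s2 sqrrN; congr (_ - _); rewrite /mean_size; ring.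
- by move=> z hz; rewrite -FE hr.
Qed.

(** The left form is the one that is symmetric under exchange of the letters, the right form the one
    to which polynomiality applies. They agree because ['C(x.+1 + y, x.+1) * x.+1 = (x.+1 + y) *
    'C(x + y, x)]. *)
Lemma moment_sum_head_eq r x y (c : rat) :
  (moment_sum r x.+1 y = c *+ 'C(x.+1 + y, x.+1)) <->
  (\sum_(w <- words x y) (centered_size x.+1%:R y%:R (true :: w) ^+ r - c) = 0).
Proof.
rewrite big_split /= big_const_seq count_predT size_words iter_addr_0.
set h := \sum_(w <- _) _.
have e : moment_sum r x.+1 y * x.+1%:R = h * (x.+1 + y)%:R.
  by rewrite !mulr_natr moment_sum_head.
have b : 'C(x.+1 + y, x.+1)%:R * x.+1%:R = (x.+1 + y)%:R * 'C(x + y, x)%:R :> rat.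
  by rewrite -!natrM mulnC -mul_bin_diag.
have x1 : (x.+1%:R : rat) != 0 by rewrite pnatr_eq0.
have y1 : ((x.+1 + y)%:R : rat) != 0 by rewrite pnatr_eq0.
rewrite mulNrn -[c *+ 'C(x.+1 + y, _)]mulr_natr -[c *+ 'C(x + y, _)]mulr_natr; split=> [m|/eqP].
  apply/eqP; rewrite subr_eq0; apply/eqP/(mulIf y1).
  by rewrite -e m -!mulrA b; congr (_ * _); rewrite mulrC.
rewrite subr_eq0 => /eqP hE; apply: (mulIf x1).
by rewrite e hE -!mulrA b; congr (_ * _); rewrite mulrC.
Qed.

(** All steps start at 0, and [mean_size a 0] cancels the constant in [core_size]. *)
Lemma centered_size_b0 (x : nat) w : w \in words x 0 ->
  centered_size x.+1%:R 0%:R (true :: w) = 0.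
Proof.
move=> hw; have x1 : (x.+1%:R : rat) != 0 by rewrite pnatr_eq0.
rewrite centered_size_true //; move: hw; rewrite mem_words => /andP[_ /eqP cw].
have z k : (0 < k)%N ->
    count_sum x.+1%:R 0%:R (fun p => p ^+ k) [seq n%:R | n <- north_counts w] = 0.
  move=> k0; elim: w cw => [|[] w IH] //=; rewrite add0n => cw; rewrite IH // cw.
  by rewrite mulr0 mul0r subr0 expr0n eqn0Ngt k0.
rewrite !z // /mean_size; move: (x.+1%:R : rat) x1 => A A1; field; exact: A1.
Qed.

(* A polynomial of degree [2 r] in [b], symmetric under [b -> - a - b], is
   determined by [r.+1] values at natural numbers; by symmetry in [a] and [b] it
   is enough to test the square [a, b <= r]. *)
Lemma moment_sum_eq r (C : rat -> rat -> rat) : (0 < r)%N ->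
  (forall a, exists2 p : {poly rat}, (size p <= (2 * r).+1)%N & forall b, C a b = p.[b]) ->
  (forall a b, C a b = C b a) ->
  (forall a b, C a (- a - b) = C a b) ->
  (forall a, C a 0 = 0) ->
  (forall x y, (x < y <= r)%N ->
    \sum_(w <- words x y) (centered_size x.+1%:R y%:R (true :: w) ^+ r - C x.+1%:R y%:R) = 0) ->
  forall x y, moment_sum r x.+1 y = C x.+1%:R y%:R *+ 'C(x.+1 + y, x.+1).
Proof.
move=> r0 Cp Csym Crec C0 Cr.
pose P x y := \sum_(w <- words x y)
   (centered_size x.+1%:R y%:R (true :: w) ^+ r - C x.+1%:R y%:R) = 0.
have all_y x : (forall y, (y <= r)%N -> P x y) -> forall y, P x y.
  have [p sp pE] := Cp x.+1%:R; rewrite /P => h y; rewrite pE.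
  apply: moment_determined => // n; first by rewrite -!pE Crec.
  by move=> nr; rewrite -pE; apply: h.
have symP x y : P x y.+1 -> P y x.+1.
  move=> /moment_sum_head_eq h; apply/moment_sum_head_eq.
  rewrite moment_sumC // h Csym addnC; congr (_ *+ _).
  by rewrite -[RHS]bin_sub ?leq_addr // addKn.
have P0 x : P x 0%N.
  rewrite /P big_seq big1 // => w hw.
  by rewrite centered_size_b0 // C0 expr0n eqn0Ngt r0 subr0.
(* For [a <= r], the tested pairs [a <= b <= r] and their mirror images cover all [b <= r]. *)
have small x : (x < r)%N -> forall y, P x y.
  move=> xr; apply: all_y => -[|y] yr; first exact: P0.
  have [xy|yx] := ltnP x y.+1; first by apply: Cr; rewrite xy yr.
  by apply: symP; apply: Cr; lia.
(* For arbitrary [a] and [0 < b <= r], the mirrored pair has first parameter at most [r], where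
   every value of the other is settled. *)
move=> x y; apply/moment_sum_head_eq; apply: all_y => -[|{}y] yr; first exact: P0.
exact/symP/small.
Qed.

Lemma moment_sum1 x y : moment_sum 1 x.+1 y = 0.
Proof.
rewrite -[RHS](mul0rn _ 'C(x.+1 + y, x.+1)).
apply: (@moment_sum_eq 1 (fun _ _ => 0)) => // {x y}.
- by move=> a; exists 0; rewrite ?size_poly0 // => b; rewrite horner0.
(* For [r = 1] the only pair to test is [a = b = 1]. *)
- move=> [|x] [|[|y]] //; last by rewrite andbF.
  rewrite -[words 0 1]/[:: [:: false]] big_seq1 subr0 => _.
  by rewrite centered_size_true // /mean_size /=; field.
Qed.

(** * Evaluation *)

(** Computations run on binary integers; [ratz] carries their results to the rationals. *)
Definition ratz (z : Z) : rat := (int_of_Z z)%:~R.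

Lemma ratzD x y : ratz (Z.add x y) = ratz x + ratz y.
Proof. by rewrite /ratz (rmorphD int_of_Z) rmorphD. Qed.

Lemma ratzN x : ratz (Z.opp x) = - ratz x.
Proof. by rewrite /ratz (rmorphN int_of_Z) rmorphN. Qed.

Lemma ratzB x y : ratz (Z.sub x y) = ratz x - ratz y.
Proof. by rewrite /Z.sub ratzD ratzN. Qed.

Lemma ratzM x y : ratz (Z.mul x y) = ratz x * ratz y.
Proof. by rewrite /ratz (rmorphM int_of_Z) rmorphM. Qed.

Lemma ratz_nat n : ratz (Z.of_nat n) = n%:R.
Proof. by rewrite /ratz -[int_of_Z _]/(int_of_Z (Z_of_int n%:Z)) Z_of_intK pmulrn. Qed.

Lemma ratz_neq0 z : z <> Z0 -> ratz z != 0.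
Proof.
move=> z0; rewrite /ratz intr_eq0; apply/eqP => e; apply: z0.
by rewrite -[z]int_of_ZK e.
Qed.

Lemma ratzX x p : ratz (Z.pow x (Zpos p)) = ratz x ^+ Pos.to_nat p.
Proof.
rewrite -positive_nat_Z; elim: (Pos.to_nat p) => [|n IH]; first by rewrite expr0.
by rewrite Nat2Z.inj_succ Z.pow_succ_r ?ratzM ?IH ?exprS //; lia.
Qed.

(** A binary trie indexed by the digits of a positive number. Many words share a size, and the ninth
    power is then taken once per distinct value. *)
Inductive tally := Empty | Node (l : tally) (n : Z) (r : tally).

Fixpoint tally_add_pos (p : positive) (t : tally) : tally :=
  let: (l, n, r) :=
    if t is Node l n r then (l, n, r) else (Empty, Z0, Empty) in
  match p with
  | xH => Node l (Z.succ n) r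
  | xO q => Node (tally_add_pos q l) n r
  | xI q => Node l n (tally_add_pos q r)
  end.

Fixpoint tally_sum_pos (f : positive -> Z) (t : tally) : Z :=
  if t is Node l n r then
    Z.add (Z.mul n (f xH))
      (Z.add (tally_sum_pos (fun p => f (xO p)) l)
             (tally_sum_pos (fun p => f (xI p)) r))
  else Z0.

(* Multiplicities of the negative numbers, of zero, and of the positive
   numbers. *)
Definition ztally : Type := tally * Z * tally.

Definition ztally_add (z : Z) (t : ztally) : ztally :=
  let: (l, n, r) := t in
  match z with
  | Z0 => (l, Z.succ n, r)
  | Zpos p => (l, n, tally_add_pos p r)
  | Zneg p => (tally_add_pos p l, n, r)
  end.

Definition ztally_sum (f : Z -> Z) (t : ztally) : Z :=
  let: (l, n, r) := t in
  Z.add (tally_sum_pos (fun p => f (Zneg p)) l)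
    (Z.add (Z.mul n (f Z0)) (tally_sum_pos (fun p => f (Zpos p)) r)).

Lemma tally_sum_pos_add f p t :
  tally_sum_pos f (tally_add_pos p t) = Z.add (f p) (tally_sum_pos f t).
Proof.
by elim: p f t => [p IH|p IH|] f [|l n r]; cbn [tally_add_pos tally_sum_pos];
  rewrite ?IH; cbn [tally_sum_pos]; lia.
Qed.

Lemma ztally_sum_add f z t :
  ztally_sum f (ztally_add z t) = Z.add (f z) (ztally_sum f t).
Proof.
by case: t => [[l n] r]; case: z => [|p|p] /=; rewrite ?tally_sum_pos_add; lia.
Qed.

(* [m] is [b (a - 1) - 2 b x], [yz] is [y], [b2] is [2 b]; [k] and [v] hold the
   contributions of the letters already read. *)
Fixpoint tally_words (a b2 : Z) (x : nat) (m : Z) (y : nat) (yz k v : Z)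
    (t : ztally) {struct x} : ztally :=
  match x with
  | 0 => ztally_add (Z.sub k (Z.mul v v)) t
  | x'.+1 => (fix north (y : nat) (yz : Z) (t : ztally) {struct y} : ztally :=
      let t' := tally_words a b2 x' (Z.add m b2) y yz
        (Z.add k (Z.mul yz (Z.add (Z.mul a yz) m))) (Z.add v yz) t in
      if y is y'.+1 then north y' (Z.pred yz) t' else t') y yz t
  end.

Fixpoint quad (a b2 m : Z) (r : seq nat) : Z :=
  if r is y :: r' then
    Z.add (Z.mul (Z.of_nat y) (Z.add (Z.mul a (Z.of_nat y)) m)) (quad a b2 (Z.add m b2) r')
  else Z0.

(** With [S1] and [S2] the power sums of the positions, [k = v = 0] and the initial [m], this is
    [(a S2 - S1^2) / a^2 - b^2 (a^2 - 1) / 12]. The cross term of [S1^2] is absorbed in [m], which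
    leaves only integers. *)
Definition key (a b2 m k v : Z) (r : seq nat) : Z :=
  let v' := Z.add v (Z.of_nat (sumn r)) in
  Z.sub (Z.add k (quad a b2 m r)) (Z.mul v' v').

Lemma ratz_sum_tally_words f a b2 x m y k v t :
  ratz (ztally_sum f (tally_words a b2 x m y (Z.of_nat y) k v t)) =
  \sum_(w <- words x y) ratz (f (key a b2 m k v (north_counts w)))
  + ratz (ztally_sum f t).
Proof.
elim: x m y k v t => [|x IHx] m y k v t.
  have r0 : north_counts (nseq y false) = [::] by elim: y.
  rewrite big_seq1 r0 /= ztally_sum_add ratzD; congr (ratz (f _) + _).
  by rewrite /key /= ; lia.
have keyE z s : key a b2 (Z.add m b2)
     (Z.add k (Z.mul (Z.of_nat z) (Z.add (Z.mul a (Z.of_nat z)) m)))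
     (Z.add v (Z.of_nat z)) s = key a b2 m k v (z :: s).
  by rewrite /key /= ; lia.
elim: y t => [|y IHy] t.
  rewrite (sum_north_counts0 _ (fun s => ratz (f (key a b2 m k v s)))).
  rewrite -[tally_words _ _ _ _ _ _ _ _ _]/(tally_words a b2 x _ 0 _ _ _ t) IHx.
  by congr (_ + _); apply: eq_bigr => w _; rewrite keyE.
rewrite (sum_north_countsS _ _ (fun s => ratz (f (key a b2 m k v s)))).
rewrite -[tally_words _ _ _ _ _ _ _ _ _]/(tally_words a b2 x.+1 m y (Z.pred (Z.of_nat y.+1))
   k v (tally_words a b2 x (Z.add m b2) y.+1 (Z.of_nat y.+1) _ _ t)).
have -> : Z.pred (Z.of_nat y.+1) = Z.of_nat y by lia.
rewrite IHy IHx addrCA addrA; congr (_ + _ + _).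
by apply: eq_bigr => w _; rewrite keyE.
Qed.

(** The scale 24 clears all denominators; the constants collect to [(a^2 - 1) (b^2 - 1) - (a - 1) (b
    - 1) (a + b + 1) = a b (a - 1) (b - 1)]. *)
Definition weight_key (x y : nat) (z : Z) : Z :=
  let a := Z.of_nat x.+1 in let b := Z.of_nat y in
  Z.add (Z.mul (Zpos 12) z)
    (Z.mul (Z.mul a b) (Z.mul (Z.sub a (Zpos 1)) (Z.sub b (Zpos 1)))).

Definition moment_tally (x y : nat) : ztally :=
  let a := Z.of_nat x.+1 in let b := Z.of_nat y in
  let b2 := Z.mul (Zpos 2) b in
  tally_words a b2 x (Z.sub (Z.mul b (Z.of_nat x)) (Z.mul b2 (Z.of_nat x))) y b Z0 Z0
    (Empty, Z0, Empty).

(** Each letter read raises [m] by [2 b]; tying [m] to [size r] while [a] stays fixed lets the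
    induction on [r] close. *)
Lemma count_sum_quad (a b : Z) r m :
  m = Z.sub (Z.mul b (Z.sub a (Zpos 1))) (Z.mul (Z.mul (Zpos 2) b) (Z.of_nat (size r))) ->
  ratz a * ratz (quad a (Z.mul (Zpos 2) b) m r) =
  count_sum (ratz a) (ratz b) (fun p => p ^+ 2) [seq n%:R | n <- r]
  + ratz a * ratz b * (ratz a - 1) * (sumn r)%:R
  - ratz b ^+ 2 * ((size r)%:R * ((size r)%:R + 1) * (2 * (size r)%:R + 1)) / 6.
Proof.
elim: r m => [|y r IH] m mE; first by rewrite /= mulr0; field.
rewrite /= ratzD mulrDr IH; last by rewrite mE /=; lia.
rewrite size_map natrD -[(size r).+1%:R]natr1 !(ratzM, ratzD) mE.
rewrite !(ratzM, ratzD, ratzB) !ratz_nat /= -[(size r).+1%:R]natr1.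
by rewrite -[ratz (Zpos 2)]/(2%:R : rat) -[ratz (Zpos 1)]/(1 : rat); field.
Qed.

Lemma count_sum_sumn (a b : rat) r :
  count_sum a b (fun p => p ^+ 1) [seq n%:R | n <- r] =
  a * (sumn r)%:R - b * ((size r)%:R * ((size r)%:R + 1)) / 2.
Proof.
elim: r => [|y r IH] /=; first by field.
by rewrite IH size_map natrD -[(size r).+1%:R]natr1 expr1; field.
Qed.

Lemma centered_size_key x y w : w \in words x y ->
  ratz (weight_key x y (key (Z.of_nat x.+1) (Z.mul (Zpos 2) (Z.of_nat y))
     (Z.sub (Z.mul (Z.of_nat y) (Z.of_nat x))
            (Z.mul (Z.mul (Zpos 2) (Z.of_nat y)) (Z.of_nat x))) Z0 Z0 (north_counts w))) =
  24 * centered_size x.+1%:R y%:R (true :: w).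
Proof.
move=> hw; rewrite centered_size_true //; have := size_north_counts_words hw.
move: (north_counts w) => r sr.
have x1 : (x.+1%:R : rat) != 0 by rewrite pnatr_eq0.
have := @count_sum_quad (Z.of_nat x.+1) (Z.of_nat y) r
   (Z.sub (Z.mul (Z.of_nat y) (Z.of_nat x))
            (Z.mul (Z.mul (Zpos 2) (Z.of_nat y)) (Z.of_nat x))).
rewrite sr !ratz_nat => /(_ ltac:(lia)) /(canRL (mulKf x1)) q.
rewrite /weight_key /key !(ratzD, ratzM, ratzB) q !ratz_nat count_sum_sumn sr /mean_size.
have -> : x%:R = x.+1%:R - 1 :> rat by rewrite -natr1 addrK.
rewrite -[ratz (Zpos 12)]/(12%:R : rat) -[ratz (Zpos 1)]/(1 : rat) -[ratz Z0]/(0 : rat).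
move: (count_sum _ _ _ _) => S; move: (x.+1%:R : rat) x1 => A A1.
by field.
Qed.

Lemma ratz_moment_tally r x y :
  ratz (ztally_sum (fun z => Z.pow (weight_key x y z) (Zpos r)) (moment_tally x y)) =
  \sum_(w <- words x y) (24 * centered_size x.+1%:R y%:R (true :: w)) ^+ Pos.to_nat r.
Proof.
rewrite /moment_tally ratz_sum_tally_words addr0 big_seq [RHS]big_seq.
by apply: eq_bigr => w hw; rewrite ratzX centered_size_key.
Qed.

(** * The ninth moment as a polynomial in symmetric functions *)

Definition eval1 (R : comNzRingType) (l : seq R) (x : R) : R :=
  foldr (fun c u => c + x * u) 0 l.

Definition eval2 (R : comNzRingType) (T : seq (seq R)) (e f : R) : R :=
  eval1 [seq eval1 l f | l <- T] e.

Lemma eval2_morph (R S : comNzRingType) (phi : {rmorphism R -> S}) T e f :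
  phi (eval2 T e f) = eval2 [seq [seq phi c | c <- l] | l <- T] (phi e) (phi f).
Proof.
have h1 l x : phi (eval1 l x) = eval1 [seq phi c | c <- l] (phi x).
  by elim: l => [|c l IH] /=; rewrite ?rmorph0 // rmorphD rmorphM IH.
rewrite /eval2 h1 -!map_comp; congr eval1; apply: eq_map => l /=; exact: h1.
Qed.

(** Bounds [i + j] over the terms [e^i f^j]. For fixed [a] both [e] and [f] are quadratic in [b], so
    this bounds the degree in [b]. *)
Definition triangular (T : Type) (l : seq (seq T)) : bool :=
  all (fun k => size (nth [::] l k) <= size l - k)%N (iota 0 (size l)).

Lemma size_eval2 (T : seq (seq rat)) (e f : {poly rat}) :
  (size e <= 3)%N -> (size f <= 3)%N -> triangular T ->
  (size (eval2 [seq [seq c%:P | c <- l] | l <- T] e f) <= (2 * size T).-1)%N.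
Proof.
have step (p q g : {poly rat}) n : (size g <= 3)%N -> (size p <= (2 * n.+1).-1)%N ->
    (size q <= (2 * n).-1)%N -> (size (p + g * q)%R <= (2 * n.+1).-1)%N.
  move=> sg sp sq; rewrite (leq_trans (size_polyD _ _)) // geq_max sp /=.
  have [->|q0] := eqVneq q 0; first by rewrite mulr0 size_poly0.
  have := size_polyMleq g q; have : (0 < size q)%N by rewrite size_poly_gt0.
  move: (size q) (size g) (size (g * q)) sg sq => i j k; lia.
move=> se sf; have h1 (l : seq rat) n : (size l <= n)%N ->
    (size (eval1 [seq c%:P | c <- l] f) <= (2 * n).-1)%N.
  elim: l n => [|c l IH] [|n] //= ln; rewrite ?size_poly0 //.
  apply: step => //; last exact: IH.
  by rewrite (leq_trans (size_polyC_leq1 _)) //; lia.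
elim: T => [|l T IH] hT /=; first by rewrite size_poly0.
have [h0 hS] : (size l <= (size T).+1)%N /\ triangular T.
  move: hT; rewrite /triangular /= subn0 => /andP[-> /allP h]; split=> //.
  by apply/allP => k hk; have := h k.+1; rewrite /= subSS; apply;
    move: hk; rewrite !mem_iota; lia.
by apply: step => //; [exact: h1 | exact: IH].
Qed.

(* With [e = a^2 + a b + b^2] and [f = a b (a + b)], the symmetric functions of
   [a], [b], [- a - b], the ninth central moment is [f (f - e + 1)] times the
   polynomial with these coefficients (of [e^i f^j] at position [(i, j)]),
   divided by [ninth_denominator].  They were found by solving the linear system
   given by the values at [2 <= a <= b <= 9]. *)
Local Open Scope Z_scope.

Definition ninth_coefficients : seq (seq Z) :=
  [:: [:: -1111525120603497600; -143660899508021280; -1096547752148940; -5426253044487;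
      -1381271136147; 715166164297; -72179864197; 1755796474];
  [:: 351250542673430400; 11159911618818480; -16417354680720; 3937297737294;
      -4927102577001; 808623026836; -26490579077];
  [:: -18997802866627200; 62128265032080; -3108004320024;
      12073306192992; -3742020385605; 178041782467];
  [:: -716330563200; 2220096522240; -11788767104544; 8951984816274; -687441761343];
  [:: -716330563200; 3581915346720; -11199598980156; 1638398421063];
  [:: -716330563200; 6257916668880; -2398427328816];
  [:: -716330563200; 1987624208880];
  [:: -716330563200]].

Definition ninth_denominator : Z := 2919482409811968000.

Local Close Scope Z_scope.

Definition ninth_numerator (a b : Z) : Z :=
  let e := Z.add (Z.add (Z.mul a a) (Z.mul a b)) (Z.mul b b) in
  let f := Z.mul (Z.mul a b) (Z.add a b) in
  let ev l x := foldr (fun c u => Z.add c (Z.mul x u)) Z0 l in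
  Z.mul (Z.mul f (Z.add (Z.sub f e) (Zpos 1)))
    (ev [seq ev l f | l <- ninth_coefficients] e).

(** Since [f - e + 1 = (a - 1) (b - 1) (a + b + 1)], the prefactor vanishes whenever [a] or [b] is 0
    or 1. *)
Definition ninth_symmetric (e f : rat) : rat :=
  f * (f - e + 1) * eval2 [seq [seq ratz c | c <- l] | l <- ninth_coefficients] e f
    / ratz ninth_denominator.

Definition ninth_moment (a b : rat) : rat :=
  ninth_symmetric (a ^+ 2 + a * b + b ^+ 2) (a * b * (a + b)).

Lemma ratz_ninth_numerator a b :
  ratz (ninth_numerator a b) = ninth_moment (ratz a) (ratz b) * ratz ninth_denominator.
Proof.
have h l x : ratz (foldr (fun c u => Z.add c (Z.mul x u)) Z0 l) =
    eval1 [seq ratz c | c <- l] (ratz x).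
  by elim: l => [|c l IH] //=; rewrite ratzD ratzM IH.
rewrite /ninth_numerator /ninth_moment /ninth_symmetric divfK ?ratz_neq0 //.
move: ninth_coefficients => T.
have e : ratz (Z.add (Z.add (Z.mul a a) (Z.mul a b)) (Z.mul b b)) =
    ratz a ^+ 2 + ratz a * ratz b + ratz b ^+ 2 by rewrite !ratzD !ratzM !expr2.
have f : ratz (Z.mul (Z.mul a b) (Z.add a b)) = ratz a * ratz b * (ratz a + ratz b).
  by rewrite ratzM ratzM ratzD.
move: (Z.add _ (Z.mul b b)) (Z.mul _ (Z.add a b)) e f => e' f' <- <-.
rewrite ratzM ratzM h ratzD ratzB; congr (_ * _).
rewrite /eval2; congr eval1; rewrite -!map_comp.
by apply: eq_map => l /=; rewrite h.
Qed.

Lemma ninth_moment_poly a : exists2 p : {poly rat},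
  (size p <= 19)%N & forall b, ninth_moment a b = p.[b].
Proof.
pose e : {poly rat} := (a ^+ 2)%:P + a%:P * 'X + 'X ^+ 2.
pose f : {poly rat} := a%:P * 'X * (a%:P + 'X).
rewrite /ninth_moment /ninth_symmetric; set T := map _ _.
have : triangular T && (size T == 8)%N by [].
move: (ratz _) T => D T /andP[tT /eqP sT].
have sC c : (size (c%:P : {poly rat}) <= 1)%N by apply: size_polyC_leq1.
have sD n (p q : {poly rat}) : (size p <= n)%N -> (size q <= n)%N -> (size (p + q)%R <= n)%N.
  by move=> sp sq; rewrite (leq_trans (size_polyD _ _)) // geq_max sp.
have sM m n (p q : {poly rat}) : (size p <= m.+1)%N -> (size q <= n.+1)%N ->
    (size (p * q)%R <= (m + n).+1)%N.
  move=> sp sq; rewrite (leq_trans (size_polyMleq _ _)) //.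
  by move: (size p) (size q) sp sq => i j; lia.
have sX : (size ('X : {poly rat}) <= 2)%N by rewrite size_polyX.
have saX : (size (a%:P * 'X)%R <= 2)%N by apply: (sM 0 1).
have se : (size e <= 3)%N.
  apply: (sD 3%N); last by rewrite size_polyXn.
  by apply: (sD 3%N); [apply: leq_trans (sC _) _ | apply: leq_trans saX _].
have sf : (size f <= 3)%N.
  by apply: (sM 1 1) => //; apply: (sD 2%N) => //; apply: leq_trans (sC _) _.
have eE b : e.[b] = a ^+ 2 + a * b + b ^+ 2 by rewrite !hornerE.
have fE b : f.[b] = a * b * (a + b) by rewrite !hornerE.
move: e f se sf eE fE {saX} => e f se sf eE fE.
exists (D^-1 *:
        (f * (f - e + 1) * eval2 [seq [seq c%:P | c <- l] | l <- T] e f)).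
  apply: leq_trans (size_scale_leq _ _) _.
  (* Degree 4 from the prefactor and 14 from [i + j <= 7] add up to the admissible [2 * 9]. *)
  apply: (sM 4 14); last by have := size_eval2 se sf tT; rewrite sT.
  apply: (sM 2 2) => //; apply: (sD 3%N); last by rewrite size_poly1.
  by apply: (sD 3%N) => //; rewrite size_polyN.
move=> b; rewrite hornerZ -[RHS]mulrC -(polyC1 rat) !(hornerM, hornerD, hornerN, hornerC).
rewrite -[(eval2 _ e f).[b]]/(horner_eval b _) eval2_morph.
have -> : [seq [seq horner_eval b c | c <- l] | l <- [seq [seq c%:P | c <- l] | l <- T]] = T.
  rewrite -map_comp -[RHS]map_id; apply: eq_map => l /=.
  rewrite -map_comp -[RHS]map_id; apply: eq_map => c /=.
  by rewrite /horner_eval hornerC.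
by rewrite /= /horner_eval eE fE.
Qed.


Lemma ninth_momentC a b : ninth_moment a b = ninth_moment b a.
Proof. rewrite /ninth_moment; apply: (f_equal2 ninth_symmetric); ring. Qed.

Lemma ninth_moment_reflect a b : ninth_moment a (- a - b) = ninth_moment a b.
Proof. rewrite /ninth_moment; apply: (f_equal2 ninth_symmetric); ring. Qed.

Lemma ninth_moment0 a : ninth_moment a 0 = 0.
Proof.
rewrite /ninth_moment /ninth_symmetric; move: (eval2 _ _ _) (ratz _) => u d.
by rewrite mulr0 !mul0r.
Qed.

Definition ninth_check (x y : nat) : bool :=
  Z.eqb
    (Z.mul ninth_denominator
      (ztally_sum (fun z => Z.pow (weight_key x y z) (Zpos 9)) (moment_tally x y)))
    (Z.mul (Z.mul (Z.pow (Zpos 24) (Zpos 9)) (Z.of_nat (size (words x y))))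
      (ninth_numerator (Z.of_nat x.+1) (Z.of_nat y))).

Lemma ninth_checkP x y : ninth_check x y ->
  \sum_(w <- words x y)
    (centered_size x.+1%:R y%:R (true :: w) ^+ 9 - ninth_moment x.+1%:R y%:R) = 0.
Proof.
have q0 : (24%:R : rat) != 0 by rewrite pnatr_eq0.
have D0 : ratz ninth_denominator != 0 by apply: ratz_neq0.
move=> /Z.eqb_eq /(congr1 ratz).
have := ratz_ninth_numerator (Z.of_nat x.+1) (Z.of_nat y); rewrite !ratz_nat.
have := ratz_moment_tally 9 x y; rewrite -[Pos.to_nat _]/9%N.
have := ratzX (Zpos 24) 9; rewrite -[Pos.to_nat _]/9%N -[ratz (Zpos 24)]/(24%:R : rat).
move: (Z.pow (Zpos 24) _) (ztally_sum _ _) (ninth_numerator _ _).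
move: ninth_denominator D0 => D D0.
move: (ninth_moment _ _) => M.
move: (24%:R : rat) q0 => q q0.
move=> c S N cE SE NE; rewrite !ratzM SE NE cE ratz_nat.
under eq_bigr do rewrite exprMn.
rewrite -mulr_sumr big_split big_const_seq count_predT iter_addr_0 mulNrn.
rewrite -[M *+ size _]mulr_natr.
have := expf_neq0 9 q0; move: (ratz D) D0 (q ^+ 9) => d d0 p p0.
move: (\sum_(w <- _) _) => U e.
apply: (mulIf d0); apply: (mulfI p0); rewrite mul0r mulr0.
have -> : p * ((U - M * (size (words x y))%:R) * d) =
  d * (p * U) - p * (size (words x y))%:R * (M * d) by ring.
by rewrite e subrr.
Qed.

(** The 45 pairs [1 <= a <= b <= 9], with at most ['C(17, 8) = 24310] words each. The 36 of them
    with [a >= 2] match the number of coefficients. *)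
Lemma ninth_check_all :
  all (fun y => all (fun x => ninth_check x y) (iota 0 y)) (iota 1 9).
Proof. by vm_cast_no_check (erefl true). Qed.

Lemma moment_sum9 x y :
  moment_sum 9 x.+1 y = ninth_moment x.+1%:R y%:R *+ 'C(x.+1 + y, x.+1).
Proof.
move: x y; apply: (@moment_sum_eq 9 ninth_moment isT ninth_moment_poly ninth_momentC
  ninth_moment_reflect ninth_moment0).
move=> x y /andP[xy y9]; apply: ninth_checkP.
have /allP/(_ y) := ninth_check_all; rewrite mem_iota => /(_ ltac:(lia)).
by move=> /allP; apply; rewrite mem_iota.
Qed.

(** * The cycle lemma *)

Import Order.TTheory.

(* A walk with steps +1 and -1 that starts at [d] and reaches -1 for the first
   time at its last step. *)
Fixpoint first_passage (d : nat) (w : seq bool) : bool :=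
  match w with
  | [::] => false
  | true :: w' => first_passage d.+1 w'
  | false :: w' => if d is d'.+1 then first_passage d' w' else w' == [::]
  end.

Definition level (w : seq bool) : int := (count id w)%:Z - (count negb w)%:Z.

Lemma level_cons x w : level (x :: w) = (if x then 1 else -1) + level w.
Proof. by case: x; rewrite /level /=; lia. Qed.

Lemma level_cat u v : level (u ++ v) = level u + level v.
Proof. by rewrite /level !count_cat; lia. Qed.

Lemma first_passageP d w :
  reflect ((forall i, (i < size w)%N -> 0 <= d%:Z + level (take i w)) /\
           d%:Z + level w = -1)
          (first_passage d w).
Proof.
elim: w d => [|x w IH] d /=.
  by apply: (iffP idP) => // -[_]; rewrite /level /=; lia.
have shift e : d%:Z + (if x then 1 else -1) = e%:Z ->
  ((forall i, (i < size w)%N -> 0 <= e%:Z + level (take i w)) /\ e%:Z + level w = -1)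
  <-> ((forall i, (i < (size w).+1)%N -> 0 <= d%:Z + level (take i (x :: w))) /\
      d%:Z + level (x :: w) = -1).
  move=> e_d; rewrite level_cons; split=> -[h1 h2]; split; try lia.
    case=> [|i] hi; first by rewrite take0 /level /=; lia.
    by rewrite /= level_cons; have := h1 i hi; lia.
  by move=> i hi; have := h1 i.+1 hi; rewrite /= level_cons; lia.
case: x shift => shift.
  by apply: (iffP (IH d.+1)) => /(shift d.+1 ltac:(lia)).
case: d shift => [|d] shift; last first.
  by apply: (iffP (IH d)) => /(shift d ltac:(lia)).
apply: (iffP eqP) => [->|[h1 h2]].
  by split => //= -[|i].
case: w h1 h2 {IH shift} => // y w h1 _.
by have := h1 1%N isT; rewrite /= level_cons /level /=; lia.
Qed.

Lemma level_rot w k i : (k < size w)%N -> level w = -1 -> (i <= size w)%N ->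
  level (take i (rot k w)) =
  if (k + i < size w)%N then level (take (k + i) w) - level (take k w)
  else level (take (k + i - size w) w) - 1 - level (take k w).
Proof.
move=> kw lw iw; have lk := level_cat (take k w) (drop k w).
rewrite cat_take_drop lw in lk.
rewrite /rot take_cat size_drop.
have tD j : (k + j <= size w)%N ->
    level (take (k + j) w) = level (take k w) + level (take j (drop k w)).
  by move=> h; rewrite takeD level_cat.
case: ltnP => h1; first by rewrite ifT ?tD; lia.
rewrite level_cat ifF; last by lia.
rewrite take_takel; last by lia.
have -> : (i - (size w - k) = k + i - size w)%N by lia.
lia.
Qed.

(* The rotations of a walk of total displacement -1 that stay nonnegative until
   the last step are those starting at the first minimum. *)
Lemma cycle_lemma w : level w = -1 ->
  (\sum_(k < size w) first_passage 0 (rot k w) = 1)%N.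
Proof.
move=> lw; have w0 : (0 < size w)%N by case: w lw.
pose c := size w; pose H k := level (take k w).
(* Prefixes that wrap around are lowered by the total displacement -1, hence the strict inequality
   for [m < k]. *)
have fpE k : (k < c)%N -> first_passage 0 (rot k w) =
   [forall m : 'I_c, if (m < k)%N then H k < H m else H k <= H m].
  move=> kc; apply/first_passageP/forallP => [[h _] m|h].
    case: ifP => mk.
      have := h (m + c - k)%N; rewrite size_rot level_rot -/c //; try (move: (ltn_ord m); lia).
      rewrite ifF; last by move: (ltn_ord m); lia.
      have -> : (k + (m + c - k) - c = m)%N by move: (ltn_ord m); lia.
      by rewrite -/(H m) -/(H k) => /(_ ltac:(move: (ltn_ord m); lia)); lia.
    have := h (m - k)%N; rewrite size_rot level_rot -/c //; try (move: (ltn_ord m); lia).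
    rewrite ifT; last by move: (ltn_ord m); lia.
    have -> : (k + (m - k) = m)%N by move: (ltn_ord m); lia.
    by rewrite -/(H m) -/(H k) => /(_ ltac:(move: (ltn_ord m); lia)); lia.
  split=> [i|]; last by rewrite add0r -lw /level !(permP (permEl (perm_rot _ _))).
  rewrite size_rot -/c => ic; rewrite level_rot //; last exact: ltnW.
  case: (ltnP (k + i) c) => h1.
    have := h (Ordinal h1); rewrite /= -/(H _) -/(H k).
    by rewrite ltnNge leq_addr /=; lia.
  have h2 : (k + i - c < c)%N by lia.
  by have := h (Ordinal h2); rewrite /H /= -/c ifT; lia.
(* As indices are below [c], minimising [H k * c + k] selects the least level and, among ties, the
   earliest index. *)
have [k0 k0c k0min] : exists2 k0 : nat, (k0 < c)%N &
    forall j : nat, (j < c)%N -> H k0 * c%:Z + k0%:Z <= H j * c%:Z + j%:Z.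
  have [k _ kmin] := Order.TotalTheory.arg_minP
    (fun k : 'I_c => H k * c%:Z + k%:Z) (i0 := Ordinal w0) (P := predT) isT.
  by exists k => // j jc; exact: kmin (Ordinal jc) isT.
have mono (u v : int) : u <= v -> u * c%:Z <= v * c%:Z by move=> uv; rewrite ler_wpM2r.
have gap (u v : int) : u < v -> u * c%:Z + c%:Z <= v * c%:Z.
  by move=> uv; rewrite -[X in _ + X]mul1r -mulrDl; apply: mono; lia.
rewrite -/c; clearbody c H.
rewrite (bigD1 (Ordinal k0c)) //= big1 ?addn0.
  rewrite fpE //; apply/eqP; rewrite eqb1; apply/forallP => -[m mc] /=.
  have le := k0min m mc; case: ltnP => mk.
    by rewrite ltNge; apply/negP => /mono; lia.
  by rewrite leNgt; apply/negP => /gap; lia.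
move=> [k kc] /= kk0; rewrite fpE //; apply/eqP; rewrite eqb0; apply/negP => /forallP hk.
have le := k0min k kc; have kn : k <> k0 by move=> e; case/eqP: kk0; apply: val_inj.
by have := hk (Ordinal k0c); rewrite /=; case: ltnP => h; [move=> /gap | move=> /mono]; lia.
Qed.

Lemma sum_words_cycle (s : nat) (F : seq bool -> rat) :
  (forall k w, w \in words s s.+1 -> F (rot k w) = F w) ->
  \sum_(w <- words s s.+1) F w =
  (\sum_(w <- words s s.+1 | first_passage 0 w) F w) *+ (s + s.+1).
Proof.
move=> FR; rewrite -rot_double_count // big_seq [RHS]big_seq; apply: eq_bigr => w hw.
rewrite -(words_size hw) cycle_lemma ?mulr1n //.
by move: hw; rewrite mem_words /level => /andP[/eqP -> /eqP ->]; lia.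
Qed.

(** * Walks and levels *)

Local Open Scope nat_scope.

Definition slow_growth : rel nat := fun x y => y <= x.+1.

Fixpoint east_levels (d : nat) (w : seq bool) : seq nat :=
  match w with
  | [::] => [::]
  | true :: w' => d :: east_levels d.+1 w'
  | false :: w' => east_levels d.-1 w'
  end.

(** After a [true] step from level [x] the walk is at [x.+1]: it takes [x.+1 - y] steps down to
    reach [y], or [x.+2] to end at -1. *)
Fixpoint word_of_levels (x : nat) (t : seq nat) : seq bool :=
  true :: (if t is y :: t' then nseq (x.+1 - y) false ++ word_of_levels y t'
           else nseq x.+2 false).

Lemma size_east_levels d w : size (east_levels d w) = count id w.
Proof. by elim: w d => [|[] w IH] d //=; rewrite IH. Qed.

Lemma east_levels_nseq d n w : east_levels d (nseq n false ++ w) = east_levels (d - n) w.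
Proof. by elim: n d => [|n IH] d /=; rewrite ?subn0 // IH; congr east_levels; lia. Qed.

Lemma first_passage_nseq d n w : n <= d ->
  first_passage d (nseq n false ++ w) = first_passage (d - n) w.
Proof. by elim: n d => [|n IH] [|d] //= nd; rewrite IH. Qed.

Lemma east_levels_word x t : path slow_growth x t ->
  east_levels x (word_of_levels x t) = x :: t.
Proof.
elim: t x => [|y t IH] x /=.
  by move=> _; rewrite -[nseq x _]cats0 (east_levels_nseq _ x [::]).
rewrite /slow_growth => /andP[xy ht].
by rewrite east_levels_nseq subKn // IH.
Qed.

Lemma first_passage_word x t : path slow_growth x t ->
  first_passage x (word_of_levels x t).
Proof.
elim: t x => [|y t IH] x /=.
  by elim: x => //.
rewrite /slow_growth => /andP[xy ht].
by rewrite first_passage_nseq ?leq_subr // subKn // IH.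
Qed.

Lemma word_of_levels_words x t : path slow_growth x t ->
  word_of_levels x t \in words (size t).+1 (x + size t).+2.
Proof.
rewrite mem_words => ht; apply/andP; split.
  elim: t x {ht} => [|y t IH] x /=; first by rewrite count_nseq mul0n.
  by rewrite count_cat count_nseq mul0n add0n add1n eqSS IH.
elim: t x ht => [|y t IH] x /=; first by rewrite count_nseq mul1n addn0.
rewrite /slow_growth => /andP[xy ht].
by rewrite count_cat count_nseq mul1n add0n (eqP (IH y ht)); apply/eqP; lia.
Qed.

Lemma first_passage_levels d w : first_passage d w ->
  if east_levels d w is y :: t then
    [/\ y <= d, w = nseq (d - y) false ++ word_of_levels y t & path slow_growth y t]
  else w = nseq d.+1 false.
Proof.
elim: w d => [|[] w IH] d //=.
  move=> /IH; rewrite subnn /=; case: (east_levels _ _) => [->|y t [yd -> ht]] //.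
  by split=> //=; rewrite /slow_growth yd.
case: d => [|d] /=; first by move=> /eqP ->.
move=> /IH; case: (east_levels _ _) => [->|y t [yd -> ht]] //.
by split=> //; rewrite ?subSn //; lia.
Qed.

Lemma first_passage0_levels s w : w \in words s.+1 s.+2 -> first_passage 0 w ->
  exists t, [/\ size t = s, path slow_growth 0 t, east_levels 0 w = 0 :: t &
                w = word_of_levels 0 t].
Proof.
move=> hw /first_passage_levels; have := size_east_levels 0 w.
move: hw; rewrite mem_words => /andP[/eqP -> _].
case: (east_levels 0 w) => [|y t] // [st] [y0].
have -> : y = 0 by lia.
by rewrite sub0n /= => -> ht; exists t.
Qed.

(** * Beta-sets *)

Definition col_hooks (l : seq nat) : seq nat :=
  [seq first_col_hook l k | k <- iota 0 (size l)].

Definition of_col_hooks (b : seq nat) : seq nat :=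
  [seq nth 0 b k - (size b - k.+1) | k <- iota 0 (size b)].

Lemma nth_col_hooks l k : k < size l -> nth 0 (col_hooks l) k = first_col_hook l k.
Proof. by move=> kl; rewrite (nth_map 0) ?size_iota // nth_iota. Qed.

Lemma nth_of_col_hooks b k : k < size b ->
  nth 0 (of_col_hooks b) k = nth 0 b k - (size b - k.+1).
Proof. by move=> kb; rewrite (nth_map 0) ?size_iota // nth_iota. Qed.

Lemma size_col_hooks l : size (col_hooks l) = size l.
Proof. by rewrite size_map size_iota. Qed.

Lemma size_of_col_hooks b : size (of_col_hooks b) = size b.
Proof. by rewrite size_map size_iota. Qed.

Lemma mem_col_hooks l n :
  reflect (exists2 k, k < size l & first_col_hook l k = n) (n \in col_hooks l).
Proof.
apply: (iffP mapP) => [[k]|[k kl <-]]; first by rewrite mem_iota => kl ->; exists k.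
by exists k => //; rewrite mem_iota.
Qed.

Lemma col_hooksK : cancel col_hooks of_col_hooks.
Proof.
move=> l; apply: (@eq_from_nth _ 0); rewrite size_of_col_hooks size_col_hooks //.
move=> k kl; rewrite nth_of_col_hooks size_col_hooks // nth_col_hooks //.
by rewrite /first_col_hook addnK.
Qed.

Lemma gtn_sorted_nth b i j : sorted gtn b -> i < j < size b -> nth 0 b j + (j - i) <= nth 0 b i.
Proof.
move=> sb; elim: j => [//|j IH] /andP[ij jb].
have h : nth 0 b j.+1 < nth 0 b j.
  by apply: (sorted_ltn_nth (leT := gtn)) => //; rewrite ?inE //; first (move=> x y z /=; lia); lia.
have [e|ne] := eqVneq i j; first by rewrite e; lia.
by have := IH ltac:(lia); lia.
Qed.

Lemma of_col_hooksK b : sorted gtn b -> col_hooks (of_col_hooks b) = b.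
Proof.
move=> sb; apply: (@eq_from_nth _ 0); rewrite size_col_hooks size_of_col_hooks //.
move=> k kb; rewrite nth_col_hooks ?size_of_col_hooks // /first_col_hook.
rewrite nth_of_col_hooks // size_of_col_hooks subnK //.
have [e|ne] := eqVneq k.+1 (size b); first by rewrite e subnn.
by have := @gtn_sorted_nth b k (size b).-1 sb ltac:(lia); lia.
Qed.

Lemma is_partition_of_col_hooks b : sorted gtn b -> 0 \notin b ->
  is_partition (of_col_hooks b).
Proof.
move=> sb b0; have pos k : k < size b -> size b - k <= nth 0 b k.
  move=> kb; have h0 : 0 < nth 0 b (size b).-1.
    have hb : (size b).-1 < size b by lia.
    by rewrite lt0n; apply: contraNneq b0 => <-; rewrite mem_nth.
  have [e|ne] := eqVneq k.+1 (size b); first by move: h0; rewrite -e /=; lia.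
  by have := @gtn_sorted_nth b k (size b).-1 sb ltac:(lia); lia.
apply/andP; split; last first.
  by apply/(all_nthP 0) => k; rewrite size_of_col_hooks => kb;
    rewrite nth_of_col_hooks //; have := pos k kb; lia.
apply/(sortedP 0) => k; rewrite size_of_col_hooks => kb.
rewrite /= !nth_of_col_hooks //; last by lia.
by have := @gtn_sorted_nth b k k.+1 sb ltac:(lia); have := pos k.+1 kb; lia.
Qed.

Lemma sorted_col_hooks l : is_partition l -> sorted gtn (col_hooks l).
Proof.
move=> pl; apply/(sortedP 0) => k; rewrite size_col_hooks => kl.
rewrite /= !nth_col_hooks //; last by lia.
by have := partition_nth_le pl (leqnSn k); rewrite /first_col_hook; lia.
Qed.

Lemma col_hooks_gt0 l : is_partition l -> 0 \notin col_hooks l.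
Proof.
move=> pl; apply/mem_col_hooks => -[k kl].
by have := partition_nth_gt0 pl kl; rewrite /first_col_hook; lia.
Qed.

(** Conversely to [core_hook_sub], let the cell [(i, j)] have hook length [s] and put
    [c = conj_part l j]. Subtracting [s] from the first-column hook of row [i] gives
    [size l + j - c - 1], strictly below the hooks of the first [c] rows and strictly above the
    others, hence missing. *)
Lemma is_coreP s l : is_partition l ->
  is_core s l <-> (forall n, n \in col_hooks l -> s <= n -> n - s \in col_hooks l).
Proof.
move=> pl; split=> [cl n /mem_col_hooks [k kl <-] sn|h i j].
  by have [b bl e] := core_hook_sub pl cl kl sn; apply/mem_col_hooks; exists b.
rewrite /is_cell /hook_length /part => /andP[/andP[i1 il] /andP[j1 jp]] hs.
have al : i.-1 < size l by lia.
pose c := find (fun v => v < j) l.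
have lt_c k : k < c -> j <= nth 0 l k.
  by move=> kc; have := before_find 0 kc; rewrite ltnNge => /negbFE.
have ge_c k : c <= k -> k < size l -> nth 0 l k < j.
  move=> ck kl; have hl : has (fun v => v < j) l by rewrite has_find; lia.
  by have := nth_find 0 hl; have := partition_nth_le pl ck; rewrite -/c; lia.
have cl : c <= size l by apply: find_size.
have cE : conj_part l j = c by apply: conj_partE.
rewrite {}cE in hs.
have ic : i.-1 < c by rewrite ltnNge; apply/negP => /ge_c /(_ al); lia.
have := h (first_col_hook l i.-1); rewrite {2 3}/first_col_hook.
have -> : first_col_hook l i.-1 \in col_hooks l by apply/mem_col_hooks; exists i.-1.
move=> /(_ isT ltac:(lia)) /mem_col_hooks [k kl].
rewrite /first_col_hook; have [kc|ck] := ltnP k c.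
  by have := lt_c k kc; lia.
by have := ge_c k ck kl; lia.
Qed.

(** * Cores and levels *)

(** An abacus with [s] runners, one per residue; runner [j] carries [nth 0 h j] beads without gaps,
    which is closure under subtraction of [s]. *)
Definition beads (s : nat) (h : seq nat) : seq nat :=
  [seq j + s * i | j <- iota 0 s, i <- iota 0 (nth 0 h j)].

Definition core_of_levels (s : nat) (h : seq nat) : seq nat :=
  of_col_hooks (sort geq (beads s h)).

Lemma mem_beads s h n : 0 < s -> (n \in beads s h) = (n %/ s < nth 0 h (n %% s)).
Proof.
move=> s0; apply/allpairsPdep/idP => [[j [i [hj hi ->]]]|hn].
  rewrite !mem_iota !add0n /= in hj hi.
  by rewrite addnC mulnC divnMDl // divn_small // addn0 modnMDl modn_small.
exists (n %% s), (n %/ s); rewrite !mem_iota !add0n /= hn ltn_pmod //.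
by rewrite mulnC addnC -divn_eq.
Qed.

Lemma uniq_beads s h : uniq (beads s h).
Proof.
apply: allpairs_uniq_dep; rewrite ?iota_uniq //; first by move=> j _; apply: iota_uniq.
move=> p q /allpairsPdep [j [i [hj _ ->]]] /allpairsPdep [j' [i' [hj' _ ->]]] /= e.
rewrite !mem_iota !add0n /= in hj hj'.
have jj : j = j'.
  by have := congr1 (modn^~ s) e; rewrite /= ![_ + s * _]addnC ![s * _]mulnC !modnMDl !modn_small.
have s0 : 0 < s by apply: leq_ltn_trans hj.
have ii : i = i' by apply/eqP; rewrite -(eqn_pmul2l s0) -(eqn_add2l j) e jj.
by rewrite jj ii.
Qed.

Lemma sorted_sort_gtn b : uniq b -> sorted gtn (sort geq b).
Proof.
move=> ub; have geq_tot : total geq by move=> x y; apply: leq_total.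
rewrite (@sorted_pairwise _ gtn); last by move=> x y z /=; lia.
have := sort_sorted geq_tot b; rewrite sorted_pairwise; last by move=> x y z /=; lia.
have : uniq (sort geq b) by rewrite sort_uniq.
elim: (sort geq b) => //= x t IH /andP[xt ut] /andP[ax pt]; rewrite IH // andbT.
apply/allP => y yt; have := allP ax y yt => /=.
by have : x != y by [apply: contraNneq xt => ->]; lia.
Qed.

Lemma eq_sorted_gtn b b' : sorted gtn b -> sorted gtn b' -> b =i b' -> b = b'.
Proof.
by apply: irr_sorted_eq => [x y z|x] /=; lia.
Qed.

Lemma core_of_levels_hooks s h : col_hooks (core_of_levels s h) = sort geq (beads s h).
Proof. by rewrite of_col_hooksK // sorted_sort_gtn // uniq_beads. Qed.

Lemma mem_core_of_levels s h n : 0 < s ->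
  (n \in col_hooks (core_of_levels s h)) = (n %/ s < nth 0 h (n %% s)).
Proof. by move=> s0; rewrite core_of_levels_hooks mem_sort mem_beads. Qed.

Lemma slow_growth_nth t i : path slow_growth 0 t -> i < size t ->
  nth 0 (0 :: t) i.+1 <= (nth 0 (0 :: t) i).+1.
Proof. by move=> /(pathP 0) h it; apply: h. Qed.

Lemma core_of_levels_core s t : size t = s -> path slow_growth 0 t ->
  simultaneous_cores s.+1 s.+2 (core_of_levels s.+1 (0 :: t)).
Proof.
move=> st ht; set l := core_of_levels _ _.
have memE n : (n \in col_hooks l) = (n %/ s.+1 < nth 0 (0 :: t) (n %% s.+1)).
  by rewrite mem_core_of_levels.
have pl : is_partition l.
  apply: is_partition_of_col_hooks; first by rewrite sorted_sort_gtn // uniq_beads.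
  by rewrite mem_sort mem_beads // mod0n div0n.
split => //; apply/is_coreP => // n; rewrite !memE => hn sn.
  have nE : n = 1 * s.+1 + (n - s.+1) by lia.
  by move: hn; rewrite {1 2}nE divnMDl // modnMDl add1n => /ltnW.
have := ltn_pmod n (ltn0Sn s); have := divn_eq n s.+1.
(* Subtracting [s.+2] moves a bead one runner back and one row down, which [slow_growth] permits;
   runner 0 has no beads, so no bead wraps around. *)
move: (n %/ s.+1) (n %% s.+1) hn => q [|j] hn nE js; first by move: hn; rewrite /=.
have q0 : 0 < q by case: q hn nE sn => // _; lia.
have -> : n - s.+2 = q.-1 * s.+1 + j.
  by rewrite nE; case: q q0 {hn nE} => // q _; rewrite mulSn /=; lia.
rewrite divnMDl // modnMDl modn_small ?divn_small //; try lia.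
by have := @slow_growth_nth t j ht ltac:(lia); lia.
Qed.

(** Closure under subtraction of [s.+1] makes the quotients in each residue class an initial
    segment, whose length is the level; closure under subtraction of [s.+2] limits the growth from
    one class to the next. *)
Lemma levels_of_core s l : simultaneous_cores s.+1 s.+2 l ->
  exists t, [/\ size t = s, path slow_growth 0 t & l = core_of_levels s.+1 (0 :: t)].
Proof.
case=> pl /(is_coreP _ pl) c1 /(is_coreP _ pl) c2.
pose cls j := [seq n %/ s.+1 | n <- col_hooks l & n %% s.+1 == j].
have uc : uniq (col_hooks l).
  by apply: sorted_uniq (sorted_col_hooks pl) => [x y z|x] /=; lia.
have ucls j : uniq (cls j).
  rewrite map_inj_in_uniq ?filter_uniq // => x y; rewrite !mem_filter.
  move=> /andP[/eqP xj _] /andP[/eqP yj _] e.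
  by rewrite (divn_eq x s.+1) (divn_eq y s.+1) e xj yj.
have mcls j q : j <= s -> (q \in cls j) = (q * s.+1 + j \in col_hooks l).
  move=> js; apply/mapP/idP => [[n]|h].
    by rewrite mem_filter => /andP[/eqP <- hn] ->; rewrite -divn_eq.
  by exists (q * s.+1 + j); rewrite ?mem_filter ?modnMDl ?modn_small ?eqxx ?h
    ?divnMDl ?divn_small ?addn0.
have down j q : j <= s -> q.+1 \in cls j -> q \in cls j.
  move=> js; rewrite !mcls // => /c1; rewrite mulSn => /(_ ltac:(lia)).
  by rewrite -addnA addKn.
have down' j q p : j <= s -> p <= q -> q \in cls j -> p \in cls j.
  move=> js; elim: q => [|q IH] pq; first by have -> : p = 0 by lia.
  have [->//|ne] := eqVneq p q.+1; move=> /(down _ _ js); apply: IH; lia.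
have memc j q : j <= s -> (q \in cls j) = (q < size (cls j)).
  move=> js; apply/idP/idP => [hq|].
    rewrite -(size_iota 0 q.+1); apply: uniq_leq_size; rewrite ?iota_uniq // => p.
    by rewrite mem_iota /= => pq; apply: down' hq.
  apply: contraTT => nq; rewrite -leqNgt -(size_iota 0 q).
  apply: uniq_leq_size => // p hp; rewrite mem_iota /= ltnNge.
  by apply: contra nq => qp; apply: down' hp.
have nth_h j : j <= s -> nth 0 [seq size (cls j) | j <- iota 0 s.+1] j = size (cls j).
  by move=> js; rewrite (nth_map 0) ?size_iota // nth_iota.
(* A nonempty class 0 would contain the hook length 0. *)
have h0 : size (cls 0) = 0.
  apply/eqP; rewrite eqn0Ngt -memc // mcls //.
  exact: col_hooks_gt0.
exists [seq size (cls j) | j <- iota 1 s]; split.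
- by rewrite size_map size_iota.
- apply/(pathP 0) => i; rewrite size_map size_iota => si.
  have hE : 0 :: [seq size (cls j) | j <- iota 1 s] = [seq size (cls j) | j <- iota 0 s.+1].
    by rewrite /= h0.
  rewrite -[nth 0 [seq size (cls j) | j <- iota 1 s] i]/(nth 0 (0 :: _) i.+1) hE !nth_h; try lia.
  rewrite /slow_growth leqNgt; apply/negP => h.
  have : (size (cls i)).+1 \in cls i.+1 by rewrite memc.
  rewrite mcls // => /c2 /(_ ltac:(lia)).
  have -> : (size (cls i)).+1 * s.+1 + i.+1 - s.+2 = size (cls i) * s.+1 + i.
    by rewrite mulSn; lia.
  by rewrite -mcls ?memc ?ltnn // ltnW.
- have <- := col_hooksK l; rewrite /core_of_levels; congr of_col_hooks.
  apply: eq_sorted_gtn; rewrite ?sorted_sort_gtn ?uniq_beads ?sorted_col_hooks // => n.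
  rewrite mem_sort mem_beads // -[0 :: _]/(0 :: [seq size (cls j) | j <- iota 1 s]).
  have -> : 0 :: [seq size (cls j) | j <- iota 1 s] = [seq size (cls j) | j <- iota 0 s.+1].
    by rewrite /= h0.
  have js : n %% s.+1 <= s by rewrite -ltnS ltn_pmod.
  by rewrite nth_h // -memc // mcls // -divn_eq.
Qed.

Lemma core_of_levels_inj s h h' : size h = s.+1 -> size h' = s.+1 ->
  core_of_levels s.+1 h = core_of_levels s.+1 h' -> h = h'.
Proof.
move=> sh sh' e; apply: (@eq_from_nth _ 0); first by rewrite sh.
move=> j; rewrite sh => js.
have E q : (q < nth 0 h j) = (q < nth 0 h' j).
  have := @mem_core_of_levels s.+1 h (q * s.+1 + j) (ltn0Sn s).
  rewrite e mem_core_of_levels // divnMDl // modnMDl modn_small // divn_small // addn0.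
  by move=> ->.
by apply/eqP; rewrite eqn_leq; apply/andP; split; rewrite leqNgt ?E ?ltnn // -E ltnn.
Qed.

Local Open Scope ring_scope.

Lemma sum_of_col_hooks b : sorted gtn b ->
  ((sumn (of_col_hooks b))%:R : rat) =
  \sum_(n <- b) n%:R - (size b)%:R * ((size b)%:R - 1) / 2.
Proof.
elim: b => [|x b IH] sb; first by rewrite big_nil /=; field.
have {}IH := IH (path_sorted sb).
have e : of_col_hooks (x :: b) = (x - size b)%N :: of_col_hooks b.
  rewrite /of_col_hooks /= subSS subn0; congr cons.
  by rewrite -[1%N]addn0 iotaDl -map_comp; apply: eq_map.
have xb : (size b <= x)%N.
  case: b sb {IH e} => // y b sb.
  by have := @gtn_sorted_nth (x :: y :: b) 0 (size b).+1 sb (ltnSn _); rewrite /=; lia.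
by rewrite e /= natrD IH big_cons natrB // -[(size b).+1%:R]natr1; field.
Qed.

Lemma sum_beads s h (f : nat -> rat) :
  \sum_(n <- beads s h) f n = \sum_(j < s) \sum_(i < nth 0%N h j) f (j + s * i)%N.
Proof.
rewrite big_allpairs_dep -(big_mkord predT (fun j => \sum_(i < nth 0%N h j) f (j + s * i)%N)).
rewrite /index_iota subn0; apply: eq_bigr => j _.
by rewrite -(big_mkord predT (fun i => f (j + s * i)%N)) /index_iota subn0.
Qed.

Lemma sum_nat_rat n : \sum_(i < n) (i%:R : rat) = n%:R * (n%:R - 1) / 2.
Proof.
elim: n => [|n IH]; first by rewrite big_ord0; field.
by rewrite big_ord_recr /= IH -[n.+1%:R]natr1; field.
Qed.

Lemma sum_sqr_nat_rat n :
  \sum_(i < n) (i%:R ^+ 2 : rat) = n%:R * (n%:R - 1) * (2 * n%:R - 1) / 6.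
Proof.
elim: n => [|n IH]; first by rewrite big_ord0; field.
by rewrite big_ord_recr /= IH -[n.+1%:R]natr1; field.
Qed.

(** The walk ends at level -1 and at height 0, so the height at a [true] step is determined by its
    level and the number of [true] letters left. For a word with [s] letters [true], it is [s] times
    the level plus the number of earlier ones. *)
Lemma step_sum_levels (s : nat) g d w : first_passage d w ->
  step_sum s%:R s.+1%:R true g w =
  \sum_(j < count id w) g (s%:R * (nth 0%N (east_levels d w) j).+1%:R - (count id w - j)%:R).
Proof.
elim: w d => [|x w IH] d; first by rewrite big_ord0.
case: x => fp; last first.
  case: d fp => [|d] /= fp; first by rewrite (eqP fp) /= add0r big_ord0.
  by rewrite (IH d fp) add0r.
have h : height s%:R s.+1%:R (true :: w) = s%:R * d.+1%:R - (count id (true :: w))%:R.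
  have /first_passageP [_] := fp; rewrite /level => e.
  have e' : count negb (true :: w) = (d + count id (true :: w)).+1 by lia.
  by rewrite /height e' -[s.+1%:R]natr1 -[d.+1%:R]natr1 -[(d + _).+1%:R]natr1 natrD; ring.
by rewrite /= -/(height _ _ _) h (IH d.+1 fp) /= big_ord_recl /= subn0.
Qed.

(** The starting point of the [j]-th [true] step, [s.+1 * h j + j], is the first vacant place on
    runner [j]. Both sides reduce to the sums [A], [B] and [N] of [h j ^+ 2], [j * h j] and
    [h j]. *)
Lemma partition_size_core s w : w \in words s.+1 s.+2 -> first_passage 0 w ->
  partition_size (core_of_levels s.+1 (east_levels 0 w)) = core_size s.+1%:R s.+2%:R w.
Proof.
move=> hw fp; rewrite /partition_size sum_of_col_hooks; last first.
  by rewrite sorted_sort_gtn // uniq_beads.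
have sb := permEl (perm_sort geq (beads s.+1 (east_levels 0 w))).
rewrite (perm_big _ sb) (perm_size sb) -sum1_size natr_sum !sum_beads.
rewrite /core_size !(step_sum_levels _ _ fp).
move: hw; rewrite mem_words => /andP[/eqP -> _].
set h := fun j : 'I_s.+1 => (nth 0%N (east_levels 0 w) j)%:R : rat.
have -> : \sum_(j < s.+1) \sum_(i < nth 0%N (east_levels 0 w) j) ((j + s.+1 * i)%:R : rat) =
   \sum_(j < s.+1) (j%:R * h j + s.+1%:R * (h j ^+ 2 - h j) / 2).
  apply: eq_bigr => j _; under eq_bigr do rewrite natrD natrM.
  rewrite big_split /= sumr_const card_ord -mulr_sumr sum_nat_rat -[_ *+ _]mulr_natr /h.
  by field.
have -> : \sum_(j < s.+1) \sum_(i < nth 0%N (east_levels 0 w) j) (1%:R : rat) =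
   \sum_(j < s.+1) h j.
  by apply: eq_bigr => j _; rewrite sumr_const card_ord.
have pE (j : 'I_s.+1) : s.+1%:R * (nth 0%N (east_levels 0 w) j).+1%:R - (s.+1 - j)%:R
    = s.+1%:R * h j + j%:R.
  by rewrite natrB ?(ltnW (ltn_ord j)) // -[(nth _ _ _).+1%:R]natr1 /h; ring.
under [X in _ = (_ * X - _) / _ - _]eq_bigr do rewrite pE.
under [X in _ = (_ - X ^+ 2) / _ - _]eq_bigr do rewrite /= pE.
pose A := \sum_(j < s.+1) h j ^+ 2; pose B := \sum_(j < s.+1) j%:R * h j.
pose N := \sum_(j < s.+1) h j.
have -> : \sum_(j < s.+1) (j%:R * h j + s.+1%:R * (h j ^+ 2 - h j) / 2) =
    B + s.+1%:R * (A - N) / 2.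
  rewrite big_split /= /A /N -sumrB -mulr_suml -mulr_sumr //.
have -> : \sum_(j < s.+1) (s.+1%:R * h j + j%:R) = s.+1%:R * N + s.+1%:R * s%:R / 2.
  by rewrite big_split /= -mulr_sumr sum_nat_rat -[s.+1%:R]natr1; congr (_ + _); field.
have -> : \sum_(j < s.+1) (s.+1%:R * h j + j%:R) ^+ 2 =
   s.+1%:R ^+ 2 * A + 2 * s.+1%:R * B + s.+1%:R * s%:R * (2 * s%:R + 1) / 6.
  have -> : s.+1%:R * s%:R * (2 * s%:R + 1) / 6 = \sum_(j < s.+1) (j%:R ^+ 2 : rat).
    by rewrite sum_sqr_nat_rat -[s.+1%:R]natr1; field.
  rewrite /A /B !mulr_sumr -!big_split /=; apply: eq_bigr => j _; ring.
rewrite -/N -[s.+1%:R]natr1; field.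
by rewrite natr1 pnatr_eq0.
Qed.

(** * Moments of the size of a core *)

Definition core_list (s : nat) : seq (seq nat) :=
  [seq core_of_levels s.+1 (east_levels 0 w) | w <- words s.+1 s.+2 & first_passage 0 w].

Lemma uniq_core_list s : uniq (core_list s).
Proof.
rewrite map_inj_in_uniq ?filter_uniq ?uniq_words // => u v.
rewrite !mem_filter => /andP[fu hu] /andP[fv hv].
have [t [st _ -> uE]] := first_passage0_levels hu fu.
have [t' [st' _ -> vE]] := first_passage0_levels hv fv.
move=> /core_of_levels_inj /= h; rewrite uE vE.
by have [->] : 0%N :: t = 0%N :: t' by apply: h; rewrite ?st ?st'.
Qed.

Lemma mem_core_list s l : l \in core_list s <-> simultaneous_cores s.+1 s.+2 l.
Proof.
split=> [/mapP[w]|/levels_of_core [t [st ht ->]]].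
  rewrite mem_filter => /andP[fw hw] ->.
  by have [t [st ht -> _]] := first_passage0_levels hw fw; apply: core_of_levels_core.
apply/mapP; exists (word_of_levels 0 t); last by rewrite east_levels_word.
rewrite mem_filter first_passage_word //=.
by have := word_of_levels_words ht; rewrite st add0n.
Qed.

Lemma uniform_expectation_core_list s (f : seq nat -> rat) :
  uniform_expectation (simultaneous_cores s.+1 s.+2) f =
  (\sum_(l <- core_list s) f l) / (size (core_list s))%:R.
Proof.
have -> : simultaneous_cores s.+1 s.+2 = [set` core_list s]%classic.
  by apply/seteqP; split=> l /mem_core_list.
rewrite /uniform_expectation -fsbig_seq ?uniq_core_list //; congr (_ / _%:R).
have -> : fset_set [set` core_list s]%classic = [fset l in core_list s]%fset.
  apply/fsetP => l; rewrite in_fset_set; last exact: finite_seq.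
  by rewrite in_fset; apply/idP/idP => [/set_mem|h] //; apply: mem_set.
by rewrite card_fseq undup_id ?uniq_core_list.
Qed.

(** Passing from cores to words multiplies every sum by the number of rotations, and so also the
    count of cores; the factor cancels in the quotient. *)
Lemma uniform_expectation_words s (g : rat -> rat) :
  uniform_expectation (simultaneous_cores s.+1 s.+2) (fun l => g (partition_size l)) =
  (\sum_(w <- words s.+1 s.+2) g (core_size s.+1%:R s.+2%:R w)) / 'C(s.+1 + s.+2, s.+1)%:R.
Proof.
have sumE (h : rat -> rat) : \sum_(w <- words s.+1 s.+2) h (core_size s.+1%:R s.+2%:R w) =
    (\sum_(l <- core_list s) h (partition_size l)) *+ (s.+1 + s.+2).
  rewrite sum_words_cycle; last by move=> k w hw; rewrite core_size_rot.
  congr (_ *+ _); rewrite /core_list big_map big_filter.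
  rewrite big_seq_cond [RHS]big_seq_cond; apply: eq_bigr => w /andP[hw fw].
  by rewrite partition_size_core.
have := sumE (fun _ => 1); rewrite !big_const_seq !count_predT !iter_addr_0 size_words => nE.
have cancel (x y : rat) : (x *+ (s.+1 + s.+2)) / (y *+ (s.+1 + s.+2)) = x / y.
  by rewrite -[x *+ _]mulr_natr -[y *+ _]mulr_natr -mulf_div divff ?mulr1 // pnatr_eq0.
by rewrite uniform_expectation_core_list sumE nE cancel.
Qed.

Lemma mean_core_size s :
  uniform_expectation (simultaneous_cores s.+1 s.+2) partition_size =
  mean_size s.+1%:R s.+2%:R.
Proof.
rewrite -[partition_size]/(fun l => id (partition_size l)) uniform_expectation_words.
have := moment_sum1 s s.+2; rewrite /moment_sum.
under eq_bigr do rewrite expr1 /centered_size.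
rewrite sumrB => /eqP; rewrite subr_eq0 => /eqP ->.
rewrite big_const_seq count_predT iter_addr_0 size_words -[_ *+ _]mulr_natr mulfK //.
by rewrite pnatr_eq0 -lt0n bin_gt0 leq_addr.
Qed.

Lemma ninth_central_moment s :
  uniform_expectation (simultaneous_cores s.+1 s.+2)
    (fun l => (partition_size l - mean_size s.+1%:R s.+2%:R) ^+ 9) =
  ninth_moment s.+1%:R s.+2%:R.
Proof.
rewrite (uniform_expectation_words _ (fun z => (z - mean_size s.+1%:R s.+2%:R) ^+ 9)).
rewrite -/(moment_sum 9 s.+1 s.+2) moment_sum9.
move: (ninth_moment _ _) => M; rewrite -[_ *+ _]mulr_natr mulfK //.
by rewrite pnatr_eq0 -lt0n bin_gt0 leq_addr.
Qed.

(** * The stated polynomial for [b = a + 1] *)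

Local Open Scope Z_scope.

Definition ninth_target (x : Z) : Z :=
    (x ^ 2 * (x - 1) * (x - 2) * (2 * x + 1) * (x + 1) ^ 2) *
    (28092743584 * x ^ 20 - 284614603048 * x ^ 19
     + 908242721124 * x ^ 18 - 87722680542 * x ^ 17
     - 4040707469643 * x ^ 16 + 1347179583168 * x ^ 15
     + 11350317109273 * x ^ 14 + 4824122583716 * x ^ 13
     - 15816684214230 * x ^ 12 - 31535118689736 * x ^ 11
     - 29475404073738 * x ^ 10 + 2671156715274 * x ^ 9
     + 63014451511513 * x ^ 8 + 79700408583680 * x ^ 7
     + 45859575725901 * x ^ 6 - 377516262865248 * x ^ 5
     + 6309067352294376 * x ^ 4 + 10737857697068736 * x ^ 3
     - 38301852570773760 * x ^ 2 - 26103018295756800 * x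
     + 48704747653094400).

(** The prefactor becomes [2 x^2 (x + 1)^2 (x - 1) (2 x + 1)]. The further factor [x - 2] reflects
    that the two (2,3)-cores have sizes 0 and 1, a symmetric distribution. The 16 is the ratio of
    [ninth_denominator] to the stated denominator. *)
Lemma ninth_numerator_succ x : ninth_numerator x (x + 1) = 16 * ninth_target x.
Proof.
by rewrite /ninth_numerator /ninth_target; cbn [foldr map ninth_coefficients]; ring.
Qed.

Local Close Scope Z_scope.

Fixpoint Z_of_uint_acc (d : Decimal.uint) (acc : Z) : Z :=
  let step n d := Z_of_uint_acc d (Z.add n (Z.mul (Zpos 10) acc)) in
  match d with
  | Decimal.Nil => acc
  | Decimal.D0 d => step Z0 d
  | Decimal.D1 d => step (Zpos 1) d
  | Decimal.D2 d => step (Zpos 2) d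
  | Decimal.D3 d => step (Zpos 3) d
  | Decimal.D4 d => step (Zpos 4) d
  | Decimal.D5 d => step (Zpos 5) d
  | Decimal.D6 d => step (Zpos 6) d
  | Decimal.D7 d => step (Zpos 7) d
  | Decimal.D8 d => step (Zpos 8) d
  | Decimal.D9 d => step (Zpos 9) d
  end.

(* Large numerals in [nat] are kept as [Nat.of_num_uint] of their decimal
   digits; they are evaluated in [Z] since unary evaluation is not feasible. *)
Lemma natr_of_num_uint d z : Z_of_uint_acc d Z0 = z ->
  (Nat.of_num_uint (Number.UIntDecimal d))%:R = ratz z.
Proof.
move=> <-; rewrite -ratz_nat; congr ratz.
rewrite -[Z0]/(Z.of_nat 0) -[Nat.of_num_uint _]/(Nat.of_uint_acc d 0).
have h n : Z.of_nat (Nat.tail_mul 10 n) = Z.mul (Zpos 10) (Z.of_nat n).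
  by rewrite Nat.tail_mul_spec Nat2Z.inj_mul.
elim: d (0%N) => [//|d IH|d IH|d IH|d IH|d IH|d IH|d IH|d IH|d IH|d IH] acc.
all: rewrite -[LHS]/(Z.of_nat (Nat.of_uint_acc d _)) IH ?Nat2Z.inj_succ h.
all: by rewrite -[RHS]/(Z_of_uint_acc d _); congr Z_of_uint_acc; lia.
Qed.

Lemma ninth_moment_succ (s : nat) :
  ninth_moment s%:R s.+1%:R =
  ratz (ninth_target (Z.of_nat s)) / ratz (Zpos 182467650613248000).
Proof.
have := ratz_ninth_numerator (Z.of_nat s) (Z.add (Z.of_nat s) (Zpos 1)).
rewrite ninth_numerator_succ ratzD ratz_nat -[ratz (Zpos 1)]/(1 : rat) natr1.
rewrite /ninth_denominator -[Zpos 2919482409811968000]/(Z.mul 16 (Zpos 182467650613248000)).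
have c0 : ratz (Zpos 16) != 0 by apply: ratz_neq0.
have d0 : ratz (Zpos 182467650613248000) != 0 by apply: ratz_neq0.
move: (ninth_moment _ _) (ninth_target _) (Zpos 182467650613248000) (Zpos 16) c0 d0.
move=> M T D c c0 d0; rewrite !ratzM mulrCA => /(mulfI c0) ->.
by rewrite mulfK.
Qed.

(* The numerals are variables here so that unification never evaluates them in
   unary. *)
Lemma ratz_ninth_target (z : Z) (x d c20 c19 c18 c17 c16 c15 c14 c13 c12
    c11 c10 c9 c8 c7 c6 c5 c4 c3 c2 c1 c0 : rat) :
  ratz z = x -> d = ratz (Zpos 182467650613248000) ->
  c20 = ratz (Zpos 28092743584) -> c19 = ratz (Zpos 284614603048) ->
  c18 = ratz (Zpos 908242721124) -> c17 = ratz (Zpos 87722680542) ->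
  c16 = ratz (Zpos 4040707469643) -> c15 = ratz (Zpos 1347179583168) ->
  c14 = ratz (Zpos 11350317109273) -> c13 = ratz (Zpos 4824122583716) ->
  c12 = ratz (Zpos 15816684214230) -> c11 = ratz (Zpos 31535118689736) ->
  c10 = ratz (Zpos 29475404073738) -> c9 = ratz (Zpos 2671156715274) ->
  c8 = ratz (Zpos 63014451511513) -> c7 = ratz (Zpos 79700408583680) ->
  c6 = ratz (Zpos 45859575725901) -> c5 = ratz (Zpos 377516262865248) ->
  c4 = ratz (Zpos 6309067352294376) -> c3 = ratz (Zpos 10737857697068736) ->
  c2 = ratz (Zpos 38301852570773760) -> c1 = ratz (Zpos 26103018295756800) ->
  c0 = ratz (Zpos 48704747653094400) ->
  ratz (ninth_target z) / ratz (Zpos 182467650613248000) =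
    1 / d *
    (x ^+ 2 * (x - 1) * (x - 2) * (2 * x + 1) * (x + 1) ^+ 2) *
    (c20 * x ^+ 20 - c19 * x ^+ 19
     + c18 * x ^+ 18 - c17 * x ^+ 17
     - c16 * x ^+ 16 + c15 * x ^+ 15
     + c14 * x ^+ 14 + c13 * x ^+ 13
     - c12 * x ^+ 12 - c11 * x ^+ 11
     - c10 * x ^+ 10 + c9 * x ^+ 9
     + c8 * x ^+ 8 + c7 * x ^+ 7
     + c6 * x ^+ 6 - c5 * x ^+ 5
     + c4 * x ^+ 4 + c3 * x ^+ 3
     - c2 * x ^+ 2 - c1 * x
     + c0).
Proof.
move=> xE hd h20 h19 h18 h17 h16 h15 h14 h13 h12 h11 h10 h9 h8 h7 h6 h5 h4 h3 h2 h1 h0.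
rewrite /ninth_target !(ratzX, ratzM, ratzB, ratzD) xE -hd.
rewrite -h20 -h19 -h18 -h17 -h16 -h15 -h14 -h13 -h12
  -h11 -h10 -h9 -h8 -h7 -h6 -h5 -h4 -h3 -h2 -h1 -h0.
rewrite -[ratz (Zpos 2)]/(2%:R : rat) -[ratz (Zpos 1)]/(1 : rat).
repeat match goal with |- context [Pos.to_nat ?p] =>
  let n := eval compute in (Pos.to_nat p) in change (Pos.to_nat p) with n end.
rewrite mul1r mulrC mulrA; reflexivity.
Qed.

Unset Implicit Arguments.

Theorem theorem9 (s : nat) (hs : (0 < s)%N) :
  let E := uniform_expectation (simultaneous_cores s s.+1) in
  let X := partition_size in
  let x : rat := s%:R in
  E (fun l => (X l - E X) ^+ 9) =
    1 / 182467650613248000%:R *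
    (x ^+ 2 * (x - 1) * (x - 2) * (2 * x + 1) * (x + 1) ^+ 2) *
    (28092743584%:R * x ^+ 20 - 284614603048%:R * x ^+ 19
     + 908242721124%:R * x ^+ 18 - 87722680542%:R * x ^+ 17
     - 4040707469643%:R * x ^+ 16 + 1347179583168%:R * x ^+ 15
     + 11350317109273%:R * x ^+ 14 + 4824122583716%:R * x ^+ 13
     - 15816684214230%:R * x ^+ 12 - 31535118689736%:R * x ^+ 11
     - 29475404073738%:R * x ^+ 10 + 2671156715274%:R * x ^+ 9
     + 63014451511513%:R * x ^+ 8 + 79700408583680%:R * x ^+ 7
     + 45859575725901%:R * x ^+ 6 - 377516262865248%:R * x ^+ 5
     + 6309067352294376%:R * x ^+ 4 + 10737857697068736%:R * x ^+ 3
     - 38301852570773760%:R * x ^+ 2 - 26103018295756800%:R * x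
     + 48704747653094400%:R).
Proof.
case: s hs => [hs|s _ E X x]; first by discriminate hs.
rewrite /E /X mean_core_size ninth_central_moment ninth_moment_succ.
apply: ratz_ninth_target; first exact: ratz_nat.
all: by apply: natr_of_num_uint; vm_compute; reflexivity.
Qed.
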